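(* Let $\Phi$ be an irreducible crystallographic root system in a Euclidean space $V$, with simple system $\Delta=\{\alpha_1,\dots,\alpha_n\}$ and positive roots $\Phi^+$, $m=|\Phi^+|$, and let $W_a$ be its affine Weyl group. Let $H^0(\widehat{X}_{W_a})$ be the set of irreducible components of the Shi variety $\widehat{X}_{W_a}$, identified with the set of admitted vectors and equipped with the componentwise partial order: $X_{W_a}[\lambda]\le X_{W_a}[\gamma]$ if and only if $\lambda_\alpha\le\gamma_\alpha$ for all $\alpha\in\Phi^+$. Then this poset $H^0(\widehat{X}_{W_a})$ is a semidistributive lattice (i.e. a lattice that is both join semidistributive and meet semidistributive).
   Context: Notation: $(\cdot,\cdot)$ is the inner product on $V$, $\alpha^\vee=2\alpha/(\alpha,\alpha)$. For $\alpha\in\Phi$, $k\in\mathbb{Z}$, $s_{\alpha,k}(x)=x-(( x,\alpha^\vee)-k)\alpha$ is the affine reflection in the hyperplane $H_{\alpha,k}=\{x\in V: (x,\alpha^\vee)=k\}$, and $W_a=\langle s_{\alpha,k}:\alpha\in\Phi,k\in\mathbb{Z}\rangle$. For $k\in\mathbb{Z}$ let $H^1_{\alpha,k}=\{x\in V: k<(x,\alpha^\vee)<k+1\}$. Alcoves are the connected components of $V\setminus\bigcup_{\alpha\in\Phi^+,k\in\mathbb{Z}}H_{\alpha,k}$; $W_a$ acts simply transitively on alcoves, $A_e=\bigcap_{\alpha\in\Phi^+}H^1_{\alpha,0}$, and $A_w=wA_e$. For each $w\in W_a$ there are unique integers $k(w,\alpha)$ ($\alpha\in\Phi^+$) with $A_w=\bigcap_{\alpha\in\Phi^+}H^1_{\alpha,k(w,\alpha)}$.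 The fundamental polytope is $P_{\mathcal H}=\bigcap_{\alpha\in\Delta}H^1_{\alpha,0}$. An admitted vector is a vector $\lambda=(\lambda_\alpha)_{\alpha\in\Phi^+}\in\mathbb{Z}^m$ of the form $\lambda_\alpha=k(w,\alpha)$ for some $w\in W_a$ with $A_w\subset P_{\mathcal H}$ (equivalently $k(w,\alpha)=0$ for all $\alpha\in\Delta$). The Shi variety $\widehat{X}_{W_a}\subset\mathbb{R}^m$ is an affine variety whose integral points are in bijection with $W_a$ via $w\mapsto (k(w,\alpha))_{\alpha\in\Phi^+}$, and it is the disjoint union of its irreducible components $X_{W_a}[\lambda]$, one for each admitted vector $\lambda$; thus $H^0(\widehat{X}_{W_a})$ is in bijection with the set of admitted vectors. *)

(* Defs.v *)
From HB Require Import structures.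
From mathcomp Require Import all_boot all_order all_algebra.
From mathcomp Require Import finmap mpoly.
From mathcomp Require Import all_classical reals.

Set Implicit Arguments.
Unset Strict Implicit.
Unset Printing Implicit Defensive.

Import Order.TTheory GRing.Theory Num.Theory.

Local Open Scope classical_set_scope.
Local Open Scope ring_scope.

Section RootSystem.
Context (R : realType) (V : vectType R) (dot : {dot V for idfun}).

Definition coroot (a : V) : V := (2 / dot a a) *: a.

(* [affine_reflection a 0] is the linear reflection along [a]. *)
Definition affine_reflection (a : V) (k : int) (x : V) : V :=
  x - (dot x (coroot a) - k%:~R) *: a.

Record root_system (Phi : {fset V}) : Prop := RootSystem {
  root_span : <<enum_fset Phi>>%VS = fullv;
  root_neq0 : 0 \notin Phi;
  root_reduced : forall a (c : R),
    a \in Phi -> c *: a \in Phi -> c = 1 \/ c = - 1;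
  root_reflection : forall a b,
    a \in Phi -> b \in Phi -> affine_reflection a 0 b \in Phi;
  root_integral : forall a b,
    a \in Phi -> b \in Phi -> dot b (coroot a) \is a Num.int
}.

Definition irreducible_roots (Phi : {fset V}) : Prop :=
  Phi <> fset0%fset /\
  forall A B : {fset V}, Phi = (A `|` B)%fset ->
    (forall a b, a \in A -> b \in B -> dot a b = 0) ->
    A = fset0%fset \/ B = fset0%fset.

Record simple_system (Phi : {fset V}) n (Delta : n.-tuple V) : Prop :=
  SimpleSystem {
  simple_root : {subset Delta <= Phi};
  simple_basis : basis_of fullv Delta;
  simple_sign : forall a, a \in Phi ->
    (forall i, 0 <= coord Delta i a) \/ (forall i, coord Delta i a <= 0)
}.

Definition posroots (Phi : {fset V}) n (Delta : n.-tuple V) : {fset V} :=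
  [fset a in Phi | [forall i, 0 <= coord Delta i a]]%fset.

Inductive affine_weyl (Phi : {fset V}) : (V -> V) -> Prop :=
| affine_weyl_id : affine_weyl Phi id
| affine_weyl_mul (a : V) (k : int) (w : V -> V) :
    a \in Phi -> affine_weyl Phi w ->
    affine_weyl Phi (affine_reflection a k \o w).

(* The open strip H^1_{a,k}. *)
Definition strip (a : V) (k : int) : set V :=
  [set x | k%:~R < dot x (coroot a) < (k + 1)%:~R].

Definition fundamental_polytope n (Delta : n.-tuple V) : set V :=
  [set x | forall a, a \in Delta -> strip a 0 x].

Section Shi.
Context (Phi : {fset V}) (n : nat) (Delta : n.-tuple V).
Local Notation Phip := (posroots Phi Delta).

Definition fundamental_alcove : set V :=
  [set x | forall a : Phip, strip (val a) 0 x].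

Definition alcove (w : V -> V) : set V := w @` fundamental_alcove.

(* [k] is the vector (k(w,a))_a; it is unique, since the open set [alcove w]
   is nonempty. *)
Definition shi_coordinates (w : V -> V) (k : {ffun Phip -> int}) : Prop :=
  alcove w = [set x | forall a : Phip, strip (val a) (k a) x].

Definition admitted (lam : {ffun Phip -> int}) : Prop :=
  exists w : V -> V, [/\ affine_weyl Phi w,
    alcove w `<=` fundamental_polytope Delta & shi_coordinates w lam].

Definition simple_coroots : n.-tuple V := [tuple of map coroot Delta].

(* The coordinate of [x] at the positive root [v]. *)
Definition coord_at (x : {ffun Phip -> R}) (v : V) : R :=
  oapp x 0 (insub v).

(* The affine subspace X[lam]: if a^vee = \sum_i c_i alpha_i^vee, then
   x_a = \sum_i c_i x_{alpha_i} + lam_a. *)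
Definition shi_component (lam : {ffun Phip -> int}) : set {ffun Phip -> R} :=
  [set x : {ffun Phip -> R} | forall a : Phip,
     x a = \sum_(i < n) coord simple_coroots i (coroot (val a))
                        * coord_at x (tnth Delta i)
           + (lam a)%:~R].

Definition shi_variety : set {ffun Phip -> R} :=
  [set x : {ffun Phip -> R} | exists2 lam, admitted lam & shi_component lam x].

End Shi.
End RootSystem.

Section Zariski.
Context (R : realType) (I : finType).

(* The coordinate of index [i : I] is the variable ['X_(enum_rank i)]. *)
Definition zero_locus (P : set {mpoly R[#|I|]}) : set {ffun I -> R} :=
  [set x : {ffun I -> R} | forall p, P p -> p.@[fun j => x (enum_val j)] = 0].

(* Irreducibility for the Zariski topology on R^I. *)
Definition zariski_irreducible (S : set {ffun I -> R}) : Prop :=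
  S !=set0 /\
  forall P Q, S `<=` zero_locus P `|` zero_locus Q ->
    S `<=` zero_locus P \/ S `<=` zero_locus Q.

Definition irreducible_component (X C : set {ffun I -> R}) : Prop :=
  [/\ zariski_irreducible C, C `<=` X &
      forall D, zariski_irreducible D -> D `<=` X -> C `<=` D -> D = C].

End Zariski.

Section H0.
Context (R : realType) (V : vectType R) (dot : {dot V for idfun}).
Context (Phi : {fset V}) (n : nat) (Delta : n.-tuple V).
Local Notation Phip := (posroots Phi Delta).

Definition H0 : Type :=
  {C : set {ffun Phip -> R} |
    irreducible_component (@shi_variety _ _ dot Phi n Delta) C}.

(* [lam] and [gam] are determined by X[lam] and X[gam]: at the point of X[lam]
   whose coordinates at the simple roots vanish, the coordinate at [a] is
   [lam a]. *)
Definition H0_le (C D : H0) : Prop :=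
  exists lam gam : {ffun Phip -> int},
    [/\ admitted dot lam, admitted dot gam,
        sval C = shi_component dot lam, sval D = shi_component dot gam &
        forall a : Phip, lam a <= gam a].

End H0.

Definition join_semidistributive d (L : latticeType d) : Prop :=
  forall x y z : L,
    (x `|` y = x `|` z -> x `|` y = x `|` (y `&` z))%O.

Definition meet_semidistributive d (L : latticeType d) : Prop :=
  forall x y z : L,
    (x `&` y = x `&` z -> x `&` y = x `&` (y `|` z))%O.

(* The relation [le] on [T] is the order of a semidistributive lattice. *)
Definition semidistributive_lattice (T : Type) (le : T -> T -> Prop) : Prop :=
  exists (d : Order.disp_t) (L : latticeType d) (f : L -> T),
    [/\ bijective f, forall x y : L, (x <= y)%O <-> le (f x) (f y),
        join_semidistributive L & meet_semidistributive L].

(* Main.v *)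
(* Write f_a(x) = (x, a^vee). A vector lam is admitted exactly when its strips
   have a common point and lam vanishes on the simple roots: W_a acts
   transitively on regions because reflecting in a hyperplane that separates two
   points lowers the number of hyperplanes between them. If rho is the point with
   f_a(rho) = 1 for all simple roots a, the admitted vectors form the interval
   between the fundamental alcove and the region just below rho in the poset of
   all regions. That poset is locally dihedral: two walls below a region w
   generate a dihedral pencil, and folding by the two reflections leads to a
   region separated from w by all hyperplanes of the pencil and by no other. By
   an induction of Bjorner, Edelman and Ziegler every interval is then a lattice.
   For semidistributivity one may replace x by a coatom c of u = x v y = x v z;
   the claim becomes that the elements below u and beyond the wall between c and
   u are closed under meets, which holds because this wall of u cannot lie
   strictly between two others of a pencil. Finally the X[lam] are pairwise
   distinct disjoint affine subspaces, finitely many of them, so they are the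
   irreducible components. *)
Require Import Defs.
From HB Require Import structures.
From mathcomp Require Import all_boot all_order all_algebra.
From mathcomp Require Import finmap mpoly.
From mathcomp Require Import all_classical reals.
From mathcomp Require Import zify ring lra.

Set Implicit Arguments.
Unset Strict Implicit.
Unset Printing Implicit Defensive.

Import Order.TTheory GRing.Theory Num.Theory.

Local Open Scope ring_scope.

(** * Posets of regions *)

Section IntegerVectors.
Context (I : finType).
Implicit Types (A B k l u v w x y z : {ffun I -> int}) (i j : I).

Definition vle k l : Prop := forall i, k i <= l i.

Definition vdec k i : {ffun I -> int} := [ffun j => k j - (j == i)%:R].
Definition vinc k i : {ffun I -> int} := [ffun j => k j + (j == i)%:R].
(** A value strictly between [k] and [k + 1] has its negative between [- k - 1] and [- k], so this
    is the vector of the image under x -> -x. *)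
Definition vneg k : {ffun I -> int} := [ffun j => - k j - 1].

Definition vdist k l : nat := (\sum_i `|(l i - k i)%R|)%N.

Lemma vnegK : involutive vneg.
Proof. by move=> k; apply/ffunP => i; rewrite !ffunE; lia. Qed.

Lemma vneg_le k l : vle (vneg k) (vneg l) = vle l k.
Proof. by apply/propext; split=> h i; have := h i; rewrite !ffunE; lia. Qed.

Lemma vle_negl k l : vle (vneg k) l = vle (vneg l) k.
Proof. by rewrite -{1}(vnegK l) vneg_le. Qed.

Lemma vneg_inc k i : vneg (vinc k i) = vdec (vneg k) i.
Proof. by apply/ffunP => j; rewrite !ffunE; lia. Qed.

Lemma vle_refl k : vle k k. Proof. by move=> i. Qed.

Lemma vle_trans l k u : vle k l -> vle l u -> vle k u.
Proof. by move=> h h' i; apply: le_trans (h i) (h' i). Qed.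

Lemma vle_anti k l : vle k l -> vle l k -> k = l.
Proof. by move=> h h'; apply/ffunP => i; apply/le_anti; rewrite h h'. Qed.

Lemma vdec_le k i : vle (vdec k i) k.
Proof. by move=> j; rewrite !ffunE; lia. Qed.

Lemma vinc_ge k i : vle k (vinc k i).
Proof. by move=> j; rewrite !ffunE; lia. Qed.

Lemma vdist_ltl A B l i : vle A B -> vle B l -> A i < B i ->
  (vdist B l < vdist A l)%N.
Proof.
move=> AB Bl ABi; rewrite /vdist (bigD1 i) //= [ltnRHS](bigD1 i) //=.
rewrite -addSn leq_add //; first by have := Bl i; lia.
by apply: leq_sum => j _; have := AB j; have := Bl j; lia.
Qed.

Lemma vle_neq A B : vle A B -> A <> B -> exists i, A i < B i.
Proof.
move=> AB neqAB; have [/forallP h|] := boolP [forall i, B i <= A i].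
  by case: neqAB; apply: vle_anti.
by rewrite negb_forall => /existsP[i]; rewrite -ltNge => ?; exists i.
Qed.

(* The poset of regions of an arrangement in which the [i]-th coordinate
   counts the hyperplanes of the [i]-th parallel class lying below the region.
   [regions_dihedral] says that two walls below [w] meet along a face of
   codimension two of [w]; [m] is the region opposite to [w] around it, and a
   coordinate changes from [w] to [m] only when the hyperplane belongs to the
   pencil spanned by the two walls. *)
Record coxeter_regions (Rg : {ffun I -> int} -> Prop) : Prop := {
  regions_opp : forall k, Rg k -> Rg (vneg k);
  regions_chain : forall A B, Rg A -> Rg B -> vle A B -> A <> B ->
    exists2 i, Rg (vdec B i) & vle A (vdec B i);
  regions_dihedral : forall w i j, i <> j ->
    Rg w -> Rg (vdec w i) -> Rg (vdec w j) ->
    exists m, [/\ Rg m, m i = w i - 1, m j = w j - 1 &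
      forall g, m g = w g \/ (m g = w g - 1 /\ forall p, Rg p ->
        (p i < w i -> p j < w j -> p g < w g) /\
        (w i <= p i -> w j <= p j -> w g <= p g))] }.

Context (Rg : {ffun I -> int} -> Prop) (cRg : coxeter_regions Rg).

Definition is_join x y u := [/\ Rg u, vle x u, vle y u &
  forall p, Rg p -> vle x p -> vle y p -> vle u p].
Definition is_meet x y m := [/\ Rg m, vle m x, vle m y &
  forall p, Rg p -> vle p x -> vle p y -> vle p m].

Lemma is_join_neg x y u :
  is_join (vneg x) (vneg y) (vneg u) = is_meet x y u.
Proof.
apply/propext; rewrite /is_join /is_meet !vneg_le; split=> -[Ru ? ? h]; split=> //.
- by rewrite -(vnegK u); apply: (regions_opp cRg).
- move=> p Rp px py; rewrite -vneg_le.
  by apply: h; rewrite ?vneg_le //; apply: (regions_opp cRg).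
- exact: (regions_opp cRg).
- move=> p Rp; rewrite !(vle_negl _ p) => px py.
  by apply: h => //; apply: (regions_opp cRg).
Qed.

Lemma is_meet_neg x y u :
  is_meet (vneg x) (vneg y) (vneg u) = is_join x y u.
Proof. by rewrite -is_join_neg !vnegK. Qed.

Lemma regions_chain_up A B : Rg A -> Rg B -> vle A B -> A <> B ->
  exists2 i, Rg (vinc A i) & vle (vinc A i) B.
Proof.
move=> RA RB AB neqAB.
have [||||i Ri Bi] := regions_chain cRg (A := vneg B) (B := vneg A).
- exact: (regions_opp cRg).
- exact: (regions_opp cRg).
- by rewrite vneg_le.
- by move/(inv_inj vnegK)/esym.
exists i; first by rewrite -[vinc _ _]vnegK vneg_inc; apply: (regions_opp cRg).
by rewrite -vneg_le vneg_inc.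
Qed.

(** The dihedral axiom read upside down through [vneg]. If the hyperplane of class [a] just above
    [w] lay in the pencil, a region below both walls would be below it too; [vinc u a] violates
    this. *)
Lemma local_join w i j : Rg w -> Rg (vinc w i) -> Rg (vinc w j) -> i <> j ->
  exists m, [/\ is_join (vinc w i) (vinc w j) m &
    forall u a, Rg u -> vle u w -> u a = w a -> Rg (vinc u a) ->
    a <> i -> a <> j -> m a = w a].
Proof.
move=> Rw Ri Rj ij.
have := regions_dihedral cRg ij (regions_opp cRg Rw).
rewrite -!vneg_inc => /(_ (regions_opp cRg Ri) (regions_opp cRg Rj)).
case=> m [Rm mi mj mP]; exists (vneg m).
have wm : vle w (vneg m).
  by move=> g; case: (mP g) => [|[+ _]]; rewrite !ffunE; lia.
split.
  split; first exact: (regions_opp cRg).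
  - move=> g; rewrite ffunE; case: eqP => [->|_]; last by have := wm g; lia.
    by move: mi; rewrite !ffunE; lia.
  - move=> g; rewrite ffunE; case: eqP => [->|_]; last by have := wm g; lia.
    by move: mj; rewrite !ffunE; lia.
  move=> p Rp ip jp g; case: (mP g) => [|[+ /(_ _ (regions_opp cRg Rp))[h _]]].
    by have := ip g; rewrite !ffunE; lia.
  move: h; rewrite !ffunE => h; move: (ip i) (jp j).
  by rewrite !ffunE !eqxx => pi pj; have := h _ _; lia.
move=> u a Ru uw ua Ra ai aj; rewrite !ffunE.
case: (mP a) => [|[_ /(_ _ (regions_opp cRg Ra))[_ h]]].
  by rewrite ffunE; lia.
move: h; rewrite !ffunE eqxx (introF eqP (nesym ai)) (introF eqP (nesym aj)).
have := uw i; have := uw j; move=> h1 h2 h; have := h _ _; lia.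
Qed.

(* Bjorner, Edelman and Ziegler: joins of pairs of upper covers propagate to
   all pairs by induction on the distance from a common lower bound to [t]. *)
Lemma join_exists t x y z : Rg t -> Rg x -> Rg y -> Rg z ->
  vle z x -> vle z y -> vle x t -> vle y t -> exists u, is_join x y u.
Proof.
move=> Rt Rx Ry; move eqN: (vdist z t) => N; move: eqN.
elim/ltn_ind: N x y z Rx Ry => N IHN x y z Rx Ry eqN Rz zx zy xt yt.
have [zEx|nzx] := pselect (z = x); first by exists y; split=> //; rewrite -zEx.
have [zEy|nzy] := pselect (z = y); first by exists x; split=> //; rewrite -zEy.
have [i Ri ix] := regions_chain_up Rz Rx zx nzx.
have [j Rj jy] := regions_chain_up Rz Ry zy nzy.
have lti a s : vle (vinc z a) s -> vle s t -> (vdist (vinc z a) t < N)%N.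
  move=> h h'; rewrite -eqN; apply: (@vdist_ltl _ _ _ a); first exact: vinc_ge.
    exact: vle_trans h h'.
  by rewrite ffunE eqxx; lia.
have [ij|nij] := pselect (i = j).
  by rewrite -ij in jy; apply: (IHN _ (lti _ _ ix xt) x y (vinc z i)).
have [m [[Rm im jm mP] _]] := local_join Rz Ri Rj nij.
have mt : vle m t by apply: mP => //; [apply: vle_trans xt|apply: vle_trans yt].
(* [vinc z i] lies below [x] and [m], then [vinc z j] below [v] and [y]; both are nearer to [t] than
   [z] is. *)
have [v [Rv xv mv vP]] :=
  IHN _ (lti _ _ ix xt) x m (vinc z i) Rx Rm erefl Ri ix im xt mt.
have vt : vle v t by apply: vP.
have [u [Ru vu yu uP]] := IHN _ (lti _ _ jy yt) v y (vinc z j) Rv Ry erefl Rj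
  (vle_trans jm mv) jy vt yt.
exists u; split=> //; first exact: vle_trans vu.
move=> p Rp xp yp; apply: uP => //; apply: vP => //; apply: mP => //.
  exact: vle_trans xp.
exact: vle_trans yp.
Qed.

(* The regions above [u] that agree with it at [a] are closed under common
   upper bounds when [u] has a wall of class [a] above it: pushing [u] through
   that wall shows that the wall cannot lie strictly between two other walls. *)
Lemma wall_upper_bound t u a y z w : Rg t -> Rg u -> Rg (vinc u a) ->
  Rg y -> Rg z -> Rg w -> vle u w -> vle w y -> vle w z ->
  vle y t -> vle z t -> y a = u a -> z a = u a ->
  exists m, [/\ Rg m, vle y m, vle z m, vle m t & m a = u a].
Proof.
move=> Rt Ru Ra + + + + + + + + ya za.
move eqN: (vdist w t) => N; move: eqN.
elim/ltn_ind: N y z w ya za => N IHN y z w ya za eqN Ry Rz Rw uw wy wz yt zt.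
have wa : w a = u a by have := uw a; have := wy a; lia.
have [wEy|nwy] := pselect (w = y); first by exists z; split=> //; rewrite -wEy.
have [wEz|nwz] := pselect (w = z); first by exists y; split=> //; rewrite -wEz.
have [i Ri iy] := regions_chain_up Rw Ry wy nwy.
have [j Rj jz] := regions_chain_up Rw Rz wz nwz.
have ai : a <> i.
  by move=> e; have := iy i; rewrite ffunE eqxx -e; lia.
have aj : a <> j.
  by move=> e; have := jz j; rewrite ffunE eqxx -e; lia.
have lti b s : vle (vinc w b) s -> vle s t -> (vdist (vinc w b) t < N)%N.
  move=> h h'; rewrite -eqN; apply: (@vdist_ltl _ _ _ b); first exact: vinc_ge.
    exact: vle_trans h h'.
  by rewrite ffunE eqxx; lia.
have ui := vle_trans uw (vinc_ge w i); have uj := vle_trans uw (vinc_ge w j).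
have [ij|nij] := pselect (i = j).
  by rewrite -ij in jz; apply: (IHN _ (lti _ _ iy yt) y z (vinc w i)).
have [m [[Rm im jm mP] ma]] := local_join Rw Ri Rj nij.
(* The wall of [u] keeps the local join from crossing class [a], so the first inductive call accepts
   [m]. *)
have {}ma : m a = u a by rewrite (ma u).
have mt : vle m t by apply: mP => //; [apply: vle_trans yt|apply: vle_trans zt].
have [v [Rv yv mv vt va]] := IHN _ (lti _ _ iy yt) y m (vinc w i) ya ma erefl
  Ry Rm Ri ui iy im yt mt.
have [s [Rs vs zs st sa]] := IHN _ (lti _ _ jz zt) v z (vinc w j) va za erefl
  Rv Rz Rj uj (vle_trans jm mv) jz vt zt.
by exists s; split=> //; apply: vle_trans vs.
Qed.

(** If [u] and [v] differ, some [vinc u a] lies below [v]. Neither [y] nor [z] can be above it, so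
    both agree with [u] at [a]; then they have a common upper bound agreeing with [u] at [a]. It
    bounds [s], against [v] being below [s]. *)
Lemma regions_meet_semidistributive t x y z u v s :
  Rg t -> Rg x -> Rg y -> Rg z -> vle y t -> vle z t ->
  is_meet x y u -> is_meet x z u -> is_join y z s -> is_meet x s v -> u = v.
Proof.
move=> Rt Rx Ry Rz yt zt [Ru ux uy uP] [_ _ uz uP'] [Rs ys zs sP].
move=> [Rv vx vs vP].
have uv : vle u v by apply: vP => //; apply: vle_trans ys.
apply: contrapT => nuv.
have [a Ra av] := regions_chain_up Ru Rv uv nuv.
have avx := vle_trans av vx.
have eq_a q : vle u q -> ~ vle (vinc u a) q -> q a = u a.
  move=> uq nq; apply: contrapT => nqa; apply: nq => g; rewrite ffunE.
  by case: eqP (uq g) => [->|_]; have := uq a; lia.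
have nle (q : {ffun I -> int}) : vle q u -> ~ vle (vinc u a) q.
  by move=> h h'; have := h a; have := h' a; rewrite ffunE eqxx; lia.
have ya : y a = u a.
  apply: eq_a => // h; apply: (nle _ _ (@vle_refl _)).
  by apply: uP.
have za : z a = u a.
  apply: eq_a => // h; apply: (nle _ _ (@vle_refl _)).
  by apply: uP'.
have [m [Rm ym zm mt ma]] :=
  wall_upper_bound Rt Ru Ra Ry Rz Ru (vle_refl _) uy uz yt zt ya za.
have sm : vle s m by apply: sP.
have := av a; have := vs a; have := sm a; rewrite ffunE eqxx; lia.
Qed.

Lemma regions_join_semidistributive t x y z u v s :
  Rg t -> Rg x -> Rg y -> Rg z -> vle t y -> vle t z ->
  is_join x y u -> is_join x z u -> is_meet y z s -> is_join x s v -> u = v.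
Proof.
have op := regions_opp cRg.
move=> Rt Rx Ry Rz ty tz.
rewrite -(is_meet_neg x y u) -(is_meet_neg x z u) -(is_join_neg y z s).
rewrite -(is_meet_neg x s v) => h1 h2 h3 h4; apply: (inv_inj vnegK).
apply: (regions_meet_semidistributive (op _ Rt)) h1 h2 h3 h4.
- exact: op.
- exact: op.
- exact: op.
- by rewrite vneg_le.
- by rewrite vneg_le.
Qed.

Lemma meet_exists t x y z : Rg t -> Rg x -> Rg y -> Rg z ->
  vle x z -> vle y z -> vle t x -> vle t y -> exists u, is_meet x y u.
Proof.
have op := regions_opp cRg.
move=> Rt Rx Ry Rz xz yz tx ty.
have [||||||||u uP] := @join_exists (vneg t) (vneg x) (vneg y) (vneg z);
  rewrite ?vneg_le //; try exact: op.
by exists (vneg u); rewrite -is_join_neg vnegK.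
Qed.

End IntegerVectors.

(** * Lattices on intervals of regions *)

Lemma lattice_of_bounds (L : choiceType) (le : rel L) (meet join : L -> L -> L) :
  reflexive le -> antisymmetric le -> transitive le ->
  (forall x y z, le x (meet y z) = le x y && le x z) ->
  (forall x y z, le (join x y) z = le x z && le y z) ->
  (forall x y z, join x y = join x z -> join x y = join x (meet y z)) ->
  (forall x y z, meet x y = meet x z -> meet x y = meet x (join y z)) ->
  exists (d : Order.disp_t) (L' : latticeType d) (f : L' -> L),
    [/\ bijective f, forall x y : L', (x <= y)%O <-> le (f x) (f y),
        join_semidistributive L' & meet_semidistributive L'].
Proof.
case: L le meet join => T [hC hE] /= le meet join.
move=> lexx le_anti le_trans lexI leUx jsd msd.
pose d := Order.Disp tt tt.
pose F := @Order.Le_isPOrder.Axioms_ d T hC hE le lexx le_anti le_trans.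
pose P : porderType d := HB.pack T hC hE F.
pose G := @Order.POrder_MeetJoin_isLattice.Build d P meet join lexI leUx.
pose Q : latticeType d := HB.pack (Order.POrder.sort P) G.
exists d, Q, id; split=> //; first by exists id.
Qed.

Section Packaging.
Context (I : finType) (Rg : {ffun I -> int} -> Prop) (cRg : coxeter_regions Rg).
Context (b t : {ffun I -> int}) (Rb : Rg b) (Rt : Rg t).

Let L : choiceType :=
  {k : {ffun I -> int} | `[< [/\ Rg k, vle b k & vle k t] >]}.

Let LP (x : L) : [/\ Rg (val x), vle b (val x) & vle (val x) t].
Proof. by case: x => k /= /asboolP. Qed.

Let mkL k (h : [/\ Rg k, vle b k & vle k t]) : L := exist _ k (asboolT h).

Let join_ex (x y : L) : exists u : L, is_join Rg (val x) (val y) (val u).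
Proof.
have [[Rx bx xt] [Ry bY yt]] := (LP x, LP y).
have [u [Ru xu yu uP]] := join_exists cRg Rt Rx Ry Rb bx bY xt yt.
have h : [/\ Rg u, vle b u & vle u t].
  by split=> //; [apply: vle_trans xu|apply: uP].
by exists (mkL h).
Qed.

Let meet_ex (x y : L) : exists u : L, is_meet Rg (val x) (val y) (val u).
Proof.
have [[Rx bx xt] [Ry bY yt]] := (LP x, LP y).
have [u [Ru ux uy uP]] := meet_exists cRg Rb Rx Ry Rt xt yt bx bY.
have h : [/\ Rg u, vle b u & vle u t].
  by split=> //; [apply: uP|apply: vle_trans xt].
by exists (mkL h).
Qed.

(** [g] identifies [T] with the interval from [b] to [t]. Joins and meets in the interval are those
    of the whole poset of regions, so semidistributivity is inherited. *)
Lemma regions_interval_lattice (T : Type) (g : T -> {ffun I -> int})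
    (le : T -> T -> Prop) :
  injective g ->
  (forall k, (exists x, g x = k) <-> [/\ Rg k, vle b k & vle k t]) ->
  (forall x y, le x y <-> vle (g x) (g y)) -> semidistributive_lattice le.
Proof.
move=> g_inj gP leP.
have [join joinP] : {join |
    forall x y : L, is_join Rg (val x) (val y) (val (join x y : L))}.
  exists (fun x y => projT1 (cid (join_ex x y))) => x y.
  exact: (projT2 (cid (join_ex x y))).
have [meet meetP] : {meet |
    forall x y : L, is_meet Rg (val x) (val y) (val (meet x y : L))}.
  exists (fun x y => projT1 (cid (meet_ex x y))) => x y.
  exact: (projT2 (cid (meet_ex x y))).
have [||||||| d [L' [f [f_bij fP jsd msd]]]] :=
    @lattice_of_bounds L (fun x y => `[< vle (val x) (val y) >]) meet join.
- by move=> x; apply/asboolP; apply: vle_refl.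
- move=> x y /andP[/asboolP xy /asboolP yx].
  by apply: val_inj; apply: vle_anti.
- by move=> y x z /asboolP xy /asboolP yz; apply/asboolP; apply: vle_trans yz.
- move=> x y z; have [_ my mz mP] := meetP y z.
  apply/asboolP/andP => [xm|[/asboolP xy /asboolP xz]].
    by split; apply/asboolP; apply: (vle_trans xm).
  by apply: mP => //; case: (LP x).
- move=> x y z; have [_ xj yj jP] := joinP x y.
  apply/asboolP/andP => [jz|[/asboolP xz /asboolP yz]].
    by split; apply/asboolP; apply: vle_trans jz.
  by apply: jP => //; case: (LP z).
- move=> x y z e; apply: val_inj.
  have [[[Rx _ _] [Ry b_y _]] [Rz bz _]] := (LP x, LP y, LP z).
  have xzu := joinP x z; rewrite -e in xzu.
  exact: (regions_join_semidistributive cRg Rb Rx Ry Rz b_y bz (joinP x y) xzu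
    (meetP y z) (joinP x (meet y z))).
- move=> x y z e; apply: val_inj.
  have [[[Rx _ _] [Ry _ yt]] [Rz _ zt]] := (LP x, LP y, LP z).
  have xzu := meetP x z; rewrite -e in xzu.
  exact: (regions_meet_semidistributive cRg Rt Rx Ry Rz yt zt (meetP x y) xzu
    (joinP y z) (meetP x (join y z))).
have hP (x : L) : exists y, g y = val x by apply/gP; apply: LP.
pose h x := projT1 (cid (hP x)).
have hK x : g (h x) = val x := projT2 (cid (hP x)).
have h'P y : [/\ Rg (g y), vle b (g y) & vle (g y) t] by apply/gP; exists y.
exists d, L', (h \o f); split=> //.
  apply: bij_comp f_bij; exists (fun y => mkL (h'P y)) => [x|y].
    by apply: val_inj; rewrite /= hK.
  by apply: g_inj; rewrite hK.
by move=> x y; rewrite fP /= leP !hK; split=> [/asboolP|h']; last apply/asboolP.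
Qed.

End Packaging.

(** * Affine reflections and regions *)

Section Pairing.
Context (R : realType) (V : vectType R) (dot : {dot V for idfun}).
Implicit Types (a b c x y z : V) (k j : int) (t : R).

Definition pairing a x : R := dot x (coroot dot a).
Local Notation f := pairing.
Local Notation refl := (affine_reflection dot).

Lemma dotC x y : dot x y = dot y x.
Proof. by rewrite hermC /= expr0 mul1r. Qed.

Lemma dotZl t x y : dot (t *: x) y = t * dot x y.
Proof. by rewrite -[t *: x]addr0 linearPl linear0l addr0. Qed.

Lemma dotZr t x y : dot x (t *: y) = t * dot x y.
Proof. by rewrite dotC dotZl dotC. Qed.

Lemma dotBl x y z : dot (x - y) z = dot x z - dot y z.
Proof. exact: linearBl. Qed.

Lemma dotBr x y z : dot x (y - z) = dot x y - dot x z.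
Proof. exact: linearBr. Qed.

Lemma dot_sumr (I : finType) x (F : I -> V) :
  dot x (\sum_i F i) = \sum_i dot x (F i).
Proof. exact: linear_sumr. Qed.

Lemma pairingE a x : f a x = 2 / dot a a * dot x a.
Proof. by rewrite /pairing /coroot dotZr. Qed.

Lemma pairingD a x y : f a (x + y) = f a x + f a y.
Proof. by rewrite /pairing linearDl. Qed.
Lemma pairingB a x y : f a (x - y) = f a x - f a y.
Proof. by rewrite /pairing linearBl. Qed.
Lemma pairingZ a t x : f a (t *: x) = t * f a x.
Proof. by rewrite /pairing dotZl. Qed.
Lemma pairingN a x : f a (- x) = - f a x.
Proof. by rewrite /pairing linearNl. Qed.

Lemma pairing_opp a x : f (- a) x = - f a x.
Proof. by rewrite !pairingE linearNr linearNl linearNr opprK mulrN. Qed.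

Lemma dot_gt0 a : a != 0 -> 0 < dot a a.
Proof. exact: neq0_dnorm_gt0. Qed.

Lemma pairing_self a : a != 0 -> f a a = 2.
Proof. by move=> /dot_gt0 a0; rewrite pairingE divfK // gt_eqF. Qed.

Lemma pairing_affine_reflection a b k x :
  f a (refl b k x) = f a x - (f b x - k%:~R) * f a b.
Proof. by rewrite /affine_reflection pairingB pairingZ. Qed.

(** The reflection preserves [dot a a], hence commutes with taking coroots. *)
Lemma pairing_reflection a b x : b != 0 ->
  f (refl b 0 a) x = f a x - f b x * f a b.
Proof.
move=> b0; have bb := gt_eqF (dot_gt0 b0).
have sE : refl b 0 a = a - f b a *: b by rewrite /affine_reflection subr0.
have dE : dot (refl b 0 a) (refl b 0 a) = dot a a.
  rewrite sE dotBr !dotBl !dotZl !dotZr.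
  rewrite pairingE (dotC b a) /=; field; by rewrite bb.
rewrite pairingE dE sE dotBr dotZr !pairingE (dotC b a).
ring.
Qed.

Lemma pairing_affine_reflectionE a b k x : b != 0 ->
  f a (refl b k x) = f (refl b 0 a) x + k%:~R * f a b.
Proof.
by move=> b0; rewrite pairing_reflection // pairing_affine_reflection; ring.
Qed.

Lemma affine_reflectionK b k : b != 0 -> involutive (refl b k).
Proof.
move=> b0 x; have h : f b (refl b k x) = 2 * k%:~R - f b x.
  by rewrite pairing_affine_reflection pairing_self //; ring.
rewrite {1}/affine_reflection -/(f b _) h {1}/affine_reflection -/(f b x).
rewrite -addrA -opprD -scalerDl.
have -> : f b x - k%:~R + (2 * k%:~R - f b x - k%:~R) = 0 :> R by ring.
by rewrite scale0r subr0.
Qed.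

End Pairing.

(** * Alcoves and transitivity of the affine Weyl group *)

Section Regions.
Context (R : realType) (V : vectType R) (dot : {dot V for idfun}).
Context (Phi : {fset V}) (rPhi : root_system dot Phi).
Implicit Types (a b c x y z p q : V) (k j : int) (t : R).
Local Notation f := (pairing dot).
Local Notation refl := (affine_reflection dot).
Local Notation fl a x := (Num.floor (f a x)).

Lemma root_nz a : a \in Phi -> a != 0.
Proof. by apply: contraTneq => ->; apply: root_neq0 rPhi. Qed.

Lemma root_opp a : a \in Phi -> - a \in Phi.
Proof.
move=> Pa; have := root_reflection rPhi Pa Pa.
rewrite /affine_reflection -/(f a a) pairing_self ?root_nz // subr0.
by rewrite (_ : a - _ = - a) //; rewrite scaler_nat mulr2n opprD addNKr.
Qed.

Lemma pairing_int a b : a \in Phi -> b \in Phi -> f a b \is a Num.int.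
Proof. exact: root_integral. Qed.

Definition generic x : Prop := forall a, a \in Phi -> f a x \isn't a Num.int.

Definition same_region x y : Prop := forall a, a \in Phi -> fl a x = fl a y.

Lemma generic_floor a k x : generic x -> a \in Phi ->
  ((k <= fl a x) = (k%:~R < f a x)) * ((fl a x < k) = (f a x < k%:~R)).
Proof.
move=> gx Pa; split; last by rewrite floor_lt_int.
rewrite floor_ge_int le_eqVlt; case: eqP => //= e.
by have := gx a Pa; rewrite -e intr_int.
Qed.

Lemma floorN_generic a x : generic x -> a \in Phi -> fl (- a) x = - fl a x - 1.
Proof.
move=> gx Pa; rewrite pairing_opp; apply: floor_def.
have := floor_itv (f a x); have [/= h _] := generic_floor (fl a x) gx Pa.
move: h; rewrite lexx => /esym h /andP[_ h'].
move: h'; rewrite !rmorphD !rmorphN /= !rmorph1; move: h; lra.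
Qed.

Lemma generic_refl b k x : b \in Phi -> generic x -> generic (refl b k x).
Proof.
move=> Pb gx a Pa; rewrite pairing_affine_reflectionE ?root_nz //.
have := gx _ (root_reflection rPhi Pb Pa); apply: contraNN => h.
rewrite -(addrK (k%:~R * f a b) (f _ x)) rpredB // rpredM ?intr_int //.
exact: pairing_int.
Qed.

Lemma floor_refl a b k x : a \in Phi -> b \in Phi ->
  fl a (refl b k x) = fl (refl b 0 a) x + Num.floor (k%:~R * f a b).
Proof.
move=> Pa Pb; rewrite pairing_affine_reflectionE ?root_nz // floorDrz //.
by rewrite rpredM ?intr_int ?pairing_int.
Qed.

Lemma same_region_refl b k x y : b \in Phi ->
  same_region x y -> same_region (refl b k x) (refl b k y).
Proof.
by move=> Pb xy a Pa; rewrite !floor_refl // xy //; apply: root_reflection.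
Qed.

Lemma perm_refl b : b \in Phi -> perm_eq (map (refl b 0) Phi) Phi.
Proof.
move=> Pb; have sK := affine_reflectionK dot 0 (root_nz Pb).
apply: uniq_perm; rewrite ?fset_uniq // ?map_inj_uniq ?fset_uniq //.
  exact: can_inj sK.
move=> a; apply/mapP/idP => [[c Pc ->]|Pa]; first exact: root_reflection.
by exists (refl b 0 a); rewrite ?sK //; apply: root_reflection.
Qed.

(** Both [c] and [- c] are counted, which lets the sum be reindexed by a reflection of [Phi]. *)
Definition separation x y : nat := (\sum_(c <- Phi) `|(fl c x - fl c y)%R|)%N.

(* Folding the segment [x, y] at the point where it crosses the mirror gives a
   path from [x] to the mirror image of [y] that crosses as many hyperplanes,
   counted with multiplicity, and only touches the mirror itself. *)
Lemma separation_refl a j x y : a \in Phi -> generic x -> generic y ->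
  f a x < j%:~R < f a y -> (separation x (refl a j y) < separation x y)%N.
Proof.
move=> Pa gx gy /andP[xj jy].
pose t := (j%:~R - f a x) / (f a y - f a x).
have d0 : 0 < f a y - f a x by lra.
have t0 : 0 < t by rewrite divr_gt0 // subr_gt0.
have t1 : t < 1 by rewrite ltr_pdivrMr // mul1r; lra.
pose p := x + t *: (y - x).
have fp c : f c p = f c x + t * (f c y - f c x).
  by rewrite pairingD pairingZ pairingB.
have pj : f a p = j%:~R by rewrite fp divfK ?gt_eqF //; ring.
have spp : refl a j p = p.
  by rewrite /affine_reflection -/(f a p) pj subrr scale0r subr0.
pose s := refl a 0.
have fold c : c \in Phi -> fl c p - fl c (refl a j y) = fl (s c) p - fl (s c) y.
  by move=> Pc; rewrite -{1}spp !floor_refl //; ring.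
have split c : (`|(fl c x - fl c y)%R| =
                `|(fl c x - fl c p)%R| + `|(fl c p - fl c y)%R|)%N.
  have [xy|/ltW yx] := leP (f c x) (f c y).
    have h1 : fl c x <= fl c p by apply: le_floor; rewrite fp; nra.
    have h2 : fl c p <= fl c y by apply: le_floor; rewrite fp; nra.
    by move: h1 h2; lia.
  have h1 : fl c y <= fl c p by apply: le_floor; rewrite fp; nra.
  have h2 : fl c p <= fl c x by apply: le_floor; rewrite fp; nra.
  by move: h1 h2; lia.
have -> : separation x y =
    (\sum_(c <- Phi) (`|(fl c x - fl c p)%R| + `|(fl (s c) p - fl (s c) y)%R|))%N.
  rewrite /separation (eq_bigr _ (fun c _ => split c)) !big_split /=.
  by congr addn; rewrite -(perm_big _ (perm_refl Pa)) big_map.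
rewrite /separation (bigD1_seq a) ?fset_uniq //= [ltnRHS](bigD1_seq a) ?fset_uniq //=.
rewrite -addSn leq_add //.
  (* At [a] the triangle inequality is strict: [p] has floor [j], whereas [x] and the image of [y]
     have smaller floors. *)
  rewrite -fold // pj intrKfloor.
  have : fl a x < j by rewrite floor_lt_int.
  have : fl a (refl a j y) < j.
    rewrite floor_lt_int pairing_affine_reflection pairing_self ?root_nz //.
    by lra.
  by lia.
rewrite big_seq_cond [leqRHS]big_seq_cond leq_sum // => c /andP[Pc _].
by rewrite -fold //; lia.
Qed.

Lemma separation_sep x y : generic x -> generic y -> ~ same_region x y ->
  exists a j, a \in Phi /\ f a x < j%:~R < f a y.
Proof.
move=> gx gy nxy.
have [a [Pa na]] : exists a, a \in Phi /\ fl a x <> fl a y.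
  apply: contrapT => h; apply: nxy => a Pa; apply: contrapT => na.
  by apply: h; exists a.
have key c : c \in Phi -> fl c x < fl c y ->
    exists a j, a \in Phi /\ f a x < j%:~R < f a y.
  move=> Pc h; exists c, (fl c y); split=> //.
  by rewrite -(generic_floor _ gx Pc).2 -(generic_floor _ gy Pc).1 h lexx.
have [h|h|//] := ltgtP (fl a x) (fl a y); first exact: (key a).
apply: (key (- a)); first exact: root_opp.
by rewrite !floorN_generic //; lia.
Qed.

(** Induction on the separation: reflecting [y] in a mirror between [x] and [y] brings it closer to
    [x], and the same reflection carries the result back. *)
Lemma affine_weyl_transitive x y : generic x -> generic y ->
  exists2 w, affine_weyl dot Phi w & generic (w x) /\ same_region (w x) y.
Proof.
move=> gx; move eqN: (separation x y) => N; move: eqN.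
elim/ltn_ind: N y => N IHN y eqN gy.
have [xy|nxy] := pselect (same_region x y).
  by exists id; first exact: affine_weyl_id.
have [a [j [Pa xjy]]] := separation_sep gx gy nxy.
have := separation_refl Pa gx gy xjy; rewrite eqN => lt.
have [w Ww [gw wy]] := IHN _ lt _ erefl (generic_refl j Pa gy).
exists (refl a j \o w); first exact: affine_weyl_mul.
split; first exact: generic_refl.
move=> c Pc /=; rewrite -[in RHS](affine_reflectionK dot j (root_nz Pa) y).
exact: same_region_refl.
Qed.

Lemma affine_weyl_same_region w x y : affine_weyl dot Phi w ->
  same_region x y -> same_region (w x) (w y).
Proof. by elim=> // a k v Pa _ IHv xy; apply/same_region_refl/IHv. Qed.

Lemma affine_weyl_generic w x : affine_weyl dot Phi w ->
  generic x -> generic (w x).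
Proof. by elim=> // a k v Pa _ IHv gx; apply/generic_refl/IHv. Qed.

(** Stands in for the inverse of [w], undoing its reflections one after another. *)
Lemma affine_weyl_preimage w x z : affine_weyl dot Phi w ->
  generic z -> same_region (w x) z ->
  exists y, [/\ generic y, same_region x y & w y = z].
Proof.
move=> Ww; elim: Ww z => [|a k v Pa Wv IHv] z gz xz; first by exists z.
have sK := affine_reflectionK dot k (root_nz Pa).
have [|y [gy xy vy]] := IHv _ (generic_refl k Pa gz).
  by have := same_region_refl k Pa xz; rewrite /= sK.
by exists y; split=> //=; rewrite vy sK.
Qed.

End Regions.

(** * Admitted vectors *)

Section Small.
Context (R : realType).
Implicit Types (u v d t e : R).

Definition small (P : R -> Prop) : Prop :=
  exists2 e, 0 < e & forall t, 0 < t < e -> P t.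

Lemma small_ex P : small P -> exists2 t, 0 < t & P t.
Proof. by case=> e e0 eP; exists (e / 2); [lra|apply: eP; lra]. Qed.

Lemma small_and P Q : small P -> small Q -> small (fun t => P t /\ Q t).
Proof.
move=> [e e0 eP] [e' e'0 eQ]; exists (Num.min e e').
  by rewrite lt_min e0.
move=> t; rewrite lt_min => /and3P[t0 te te'].
by split; [apply: eP|apply: eQ]; rewrite t0.
Qed.

Lemma small_imp P Q : (forall t, 0 < t -> P t -> Q t) -> small P -> small Q.
Proof.
by move=> PQ [e e0 eP]; exists e => // t /[dup] /andP[t0 _] /eP; apply: PQ.
Qed.

Lemma small_all (T : eqType) (s : seq T) (P : T -> R -> Prop) :
  (forall i, i \in s -> small (P i)) ->
  small (fun t => forall i, i \in s -> P i t).
Proof.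
elim: s => [|i s IHs] sP; first by exists 1.
have si : small (P i) by apply: sP; rewrite mem_head.
have ss := IHs (fun j js => sP j (mem_behead (js : j \in behead (i :: s)))).
apply: small_imp (small_and si ss) => t _ [Pi Ps] j.
by rewrite inE => /predU1P[->|/Ps].
Qed.

Lemma small_forall (T : finType) (P : T -> R -> Prop) :
  (forall i, small (P i)) -> small (fun t => forall i, P i t).
Proof.
move=> sP; have := @small_all T (enum T) P (fun i _ => sP i).
by apply: small_imp => t _ h i; apply: h; rewrite mem_enum.
Qed.

Lemma small_lt u d v : u < v -> small (fun t => u + t * d < v).
Proof.
move=> uv; have d0 : 0 < `|d| + 1 by rewrite ltr_wpDl.
exists ((v - u) / (`|d| + 1)) => [|t /andP[t0]]; first by rewrite divr_gt0 // subr_gt0.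
rewrite ltr_pdivlMr // mulrDr mulr1 => h.
have : t * d <= t * `|d| by rewrite ler_wpM2l ?ler_norm // ltW.
by lra.
Qed.

Lemma small_gt u d v : v < u -> small (fun t => v < u + t * d).
Proof.
move=> uv; apply: small_imp (@small_lt (- u) (- d) (- v) _); last by lra.
by move=> t _; rewrite mulrN; lra.
Qed.

Lemma nonint_between (k : int) u : k%:~R < u < (k + 1)%:~R -> u \isn't a Num.int.
Proof.
move=> /andP[ku uk]; rewrite intrEfloor (floor_def (m := k)) ?uk ?(ltW ku) //.
by rewrite lt_eqF.
Qed.

Lemma small_nonint u d : u \isn't a Num.int \/ d != 0 ->
  small (fun t => u + t * d \isn't a Num.int).
Proof.
set k := Num.floor u; have /andP[ku uk] := floor_itv u; rewrite -/k in ku uk.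
have [ltku _|geku [|d0]] := ltP k%:~R u.
- apply: small_imp (small_and (small_gt d ltku) (small_lt d uk)) => t _ [h h'].
  by apply: (@nonint_between k); rewrite h.
- by rewrite intrEfloor eq_le ku geku.
have uE : u = k%:~R by apply/le_anti; rewrite ku geku.
move: d0; rewrite neq_lt => /orP[d0|d0].
  have h : (k - 1)%:~R < u by rewrite uE ltr_int; lia.
  apply: small_imp (small_gt d h) => t t0 ht.
  apply: (@nonint_between (k - 1)); rewrite ht subrK -uE.
  by rewrite -subr_gt0 opprD addNKr -mulrN mulr_gt0 // oppr_gt0.
apply: small_imp (small_lt d uk) => t t0 ht.
by apply: (@nonint_between k); rewrite ht -uE ltrDl mulr_gt0.
Qed.

End Small.

(** * Vectors of alcoves and the fundamental polytope *)

Section Shi.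
Context (R : realType) (V : vectType R) (dot : {dot V for idfun}).
Context (Phi : {fset V}) (n : nat) (Delta : n.-tuple V).
Context (rPhi : root_system dot Phi) (sDelta : simple_system Phi Delta).
Implicit Types (a b c x y z p q : V) (k j : int) (t : R).
Local Notation f := (pairing dot).
Local Notation refl := (affine_reflection dot).
Local Notation fl a x := (Num.floor (f a x)).
Local Notation Phip := (posroots Phi Delta).
Local Notation generic := (generic dot Phi).
Local Notation same_region := (same_region dot Phi).
Local Notation vec := {ffun Phip -> int}.
Implicit Types (lam A B C : vec) (al be ga : Phip).

Lemma posrootP a : reflect (a \in Phi /\ forall i, 0 <= coord Delta i a) (a \in Phip).
Proof.
by rewrite !inE /=; apply: (iffP andP) => -[Pa /forallP h]; split=> //.
Qed.

Lemma posroot_root al : val al \in Phi.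
Proof. by have /posrootP[] := valP al. Qed.
Hint Resolve posroot_root : core.

Lemma root_sign a : a \in Phi -> a \in Phip \/ - a \in Phip.
Proof.
move=> Pa; have [h|h] := simple_sign sDelta Pa; [left|right].
  by apply/posrootP.
apply/posrootP; split=> [|i]; first exact: (root_opp rPhi).
rewrite linearN oppr_ge0; exact: h.
Qed.

Lemma posroot_coord_eq0 a : a \in Phi -> (forall i, coord Delta i a = 0) -> False.
Proof.
move=> Pa h; have /negP := root_nz rPhi Pa; apply; apply/eqP.
have -> : a = \sum_(i < n) coord Delta i a *: Delta`_i.
  by apply: coord_basis; [apply: simple_basis sDelta|apply: memvf].
by rewrite big1 // => i _; rewrite h scale0r.
Qed.

Lemma posroot_not_opp a : a \in Phip -> - a \in Phip -> False.
Proof.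
move=> /posrootP[Pa ha] /posrootP[_ hNa]; apply: (posroot_coord_eq0 Pa) => i.
by apply/le_anti; rewrite ha andbT -oppr_ge0 -linearN; apply: hNa.
Qed.

Lemma generic_pos x : (forall al, f (val al) x \isn't a Num.int) -> generic x.
Proof.
move=> h a /root_sign[Pa|Pa]; first exact: (h (FSetSub Pa)).
by have := h (FSetSub Pa); rewrite /= pairing_opp rpredN.
Qed.

Definition region lam : V -> Prop :=
  fun x => forall al, strip dot (val al) (lam al) x.
Definition Rg lam : Prop := exists x, region lam x.
Definition cell x : vec := [ffun al => fl (val al) x].

Lemma region_generic lam x : region lam x -> generic x.
Proof. by move=> h; apply: generic_pos => al; apply: nonint_between (h al). Qed.

Lemma region_cell lam x : region lam x -> cell x = lam.
Proof.
move=> h; apply/ffunP => al; rewrite ffunE; apply: floor_def.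
by have /andP[/ltW -> ->] := h al.
Qed.

Lemma cell_region x : generic x -> region (cell x) x.
Proof.
move=> gx al; rewrite /strip /= ffunE -/(f _ _) floorD1_gt andbT.
by rewrite -(generic_floor _ gx (posroot_root al)).1.
Qed.

Lemma Rg_cell x : generic x -> Rg (cell x).
Proof. by move=> gx; exists x; apply: cell_region. Qed.

Lemma RgP lam : Rg lam -> exists2 x, generic x & cell x = lam.
Proof. by case=> x lx; exists x; [apply: region_generic lx|apply: region_cell]. Qed.

Lemma same_cell x y : generic x -> generic y ->
  same_region x y <-> cell x = cell y.
Proof.
move=> gx gy; split=> [h|/ffunP h a].
  by apply/ffunP => al; rewrite !ffunE h.
have key (Pa : a \in Phip) : fl a x = fl a y.
  by have := h (FSetSub Pa); rewrite !ffunE.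
move=> /root_sign[//|Pa]; have Pna := (posrootP _ Pa).1.
have := h (FSetSub Pa); rewrite !ffunE /= => e.
by rewrite -(opprK a) !(floorN_generic _ Pna) // e.
Qed.

(** If the form of a root is an integer at [z], it differs from its value at the generic [x], so it
    varies along the segment. *)
Lemma generic_perturb x z : generic x ->
  small (fun t => generic (z + t *: (x - z))).
Proof.
move=> gx; apply: small_all => a Pa.
apply: small_imp (@small_nonint _ (f a z) (f a (x - z)) _) => [t _|].
  by rewrite (pairingD _ _ z) pairingZ.
have [e|] := boolP (f a z \is a Num.int); last by left.
by right; rewrite pairingB subr_eq0; apply: contraNneq (gx a Pa) => ->.
Qed.

(** Coefficient of a simple coroot in the coroot of [ga]: passing from roots to coroots rescales the
    coordinates by squared lengths. *)
Definition simple_weight ga (i : 'I_n) : R :=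
  coord Delta i (val ga) * (dot Delta`_i Delta`_i / dot (val ga) (val ga)).

Lemma simple_nth_root (i : 'I_n) : Delta`_i \in Phi.
Proof. by apply: (simple_root sDelta); rewrite mem_nth // size_tuple. Qed.

Lemma simple_weight_ge0 ga i : 0 <= simple_weight ga i.
Proof.
have /posrootP[Pg h] := valP ga.
rewrite mulr_ge0 // divr_ge0 // ltW // dot_gt0 //; apply: (root_nz rPhi) => //.
exact: simple_nth_root.
Qed.

Lemma coroot_simple ga :
  coroot dot (val ga) = \sum_(i < n) simple_weight ga i *: coroot dot Delta`_i.
Proof.
rewrite /coroot.
have aE := coord_basis (simple_basis sDelta) (memvf (val ga)).
transitivity ((2 / dot (val ga) (val ga)) *:
    \sum_(i < n) coord Delta i (val ga) *: Delta`_i); first by rewrite -aE.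
rewrite scaler_sumr; apply: eq_bigr => i _.
rewrite !scalerA /simple_weight; congr (_ *: _).
have h1 := gt_eqF (dot_gt0 dot (root_nz rPhi (simple_nth_root i))).
have h2 := gt_eqF (dot_gt0 dot (root_nz rPhi (posroot_root ga))).
by field; rewrite h1 h2.
Qed.

Lemma pairing_simple ga x :
  f (val ga) x = \sum_(i < n) simple_weight ga i * f Delta`_i x.
Proof.
rewrite /pairing coroot_simple dot_sumr; apply: eq_bigr => i _.
exact: dotZr.
Qed.

Lemma simple_weight_gt0 ga : exists i, 0 < simple_weight ga i.
Proof.
apply: contrapT => h; apply: (posroot_coord_eq0 (posroot_root ga)) => i.
have : simple_weight ga i = 0.
  apply/le_anti; rewrite simple_weight_ge0 andbT leNgt; apply/negP => h'.
  by apply: h; exists i.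
move/eqP; rewrite !mulf_eq0 invr_eq0.
rewrite !(gt_eqF (dot_gt0 dot (root_nz rPhi _))) ?simple_nth_root // !orbF.
by move/eqP.
Qed.

(** The simple roots form a basis and the form is definite, so pairing with them is an injective
    linear map into a space of the same dimension. *)
Lemma rho_exists : exists rho, forall i : 'I_n, f Delta`_i rho = 1.
Proof.
pose F (x : V) : 'rV[R]_n := \row_i f Delta`_i x.
have Flin : linear F.
  move=> t x y; apply/rowP => i; rewrite !mxE.
  by rewrite pairingD pairingZ.
pose G : {linear V -> 'rV[R]_n} :=
  HB.pack F (GRing.isLinear.Build R V _ _ F Flin).
pose L := linfun G.
have kL : lker L = 0%VS.
  apply/eqP; rewrite -subv0; apply/subvP => x; rewrite memv_ker lfunE /= => /eqP Fx.
  rewrite memv0; apply/contraT => /(dot_gt0 dot).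
  rewrite {2}(coord_basis (simple_basis sDelta) (memvf x)) dot_sumr big1 ?ltxx //.
  move=> i _; rewrite dotZr; have /rowP/(_ i) := Fx; rewrite !mxE pairingE => /eqP.
  rewrite !mulf_eq0 invr_eq0 (gt_eqF (dot_gt0 dot (root_nz rPhi (simple_nth_root i)))).
  by rewrite pnatr_eq0 /= => /eqP ->; rewrite mulr0.
have imL : limg L = fullv.
  apply/eqP; rewrite eqEdim subvf /= (limg_dim_eq _) ?kL ?capv0 //.
  by rewrite (vector.size_basis (simple_basis sDelta)) dimvf dim_matrix; lia.
have /memv_imgP[rho _ rhoE] : const_mx 1 \in limg L by rewrite imL memvf.
exists rho => i; move: rhoE; rewrite lfunE /= => /rowP/(_ i).
by rewrite !mxE.
Qed.

Lemma pairing_rho_gt0 rho ga : (forall i : 'I_n, f Delta`_i rho = 1) ->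
  0 < f (val ga) rho.
Proof.
move=> hrho; have [i wi] := simple_weight_gt0 ga.
rewrite pairing_simple (bigD1 i) //= hrho mulr1 ltr_wpDr // sumr_ge0 // => j _.
by rewrite hrho mulr1 simple_weight_ge0.
Qed.

Lemma simple_posroot (i : 'I_n) : Delta`_i \in Phip.
Proof.
apply/posrootP; split=> [|j]; first exact: simple_nth_root.
by rewrite coord_free ?ler0n //; apply: basis_free (simple_basis sDelta).
Qed.

Definition alcove0 : vec := [ffun=> 0].

(** A small positive multiple of rho pairs with every positive root to a value between 0 and 1. *)
Lemma region_alcove0 : Rg alcove0.
Proof.
have [rho hrho] := rho_exists.
have h : small (fun t => forall ga, 0 < t * f (val ga) rho < 1).
  apply: small_forall => ga; have h0 := pairing_rho_gt0 ga hrho.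
  apply: small_imp (small_lt (f (val ga) rho) ltr01) => t t0.
  by rewrite add0r => ->; rewrite mulr_gt0.
have [t t0 ht] := small_ex h; exists (t *: rho) => ga.
by rewrite /strip /= ffunE -/(f _ _) pairingZ; apply: ht.
Qed.

(* The region just below the point where all simple coroots equal 1. *)
Lemma region_top : exists top : vec,
  [/\ Rg top, forall i, top (FSetSub (simple_posroot i)) = 0 &
  forall x, generic x -> (forall i : 'I_n, f Delta`_i x < 1) -> vle (cell x) top].
Proof.
have [rho hrho] := rho_exists.
(* [N ga] is the largest integer strictly below the value at rho; the points just below rho stay
   above it. *)
pose h ga := f (val ga) rho; pose N ga := Num.ceil (h ga) - 1.
have Nh ga : (N ga)%:~R < h ga by have /andP[] := ceil_itv (h ga).
have s1 : small (fun e => forall ga,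
    h ga + e * - h ga \isn't a Num.int /\ (N ga)%:~R < h ga + e * - h ga).
  apply: small_forall => ga; apply: small_and; last exact: small_gt.
  by apply: small_nonint; right; rewrite oppr_eq0 gt_eqF ?pairing_rho_gt0.
have [e e0 [he e1]] := small_ex (small_and s1 (small_lt 1 (ltr01 : 0 < 1 :> R))).
rewrite add0r mulr1 in e1.
pose y := rho - e *: rho.
have fy ga : f (val ga) y = h ga + e * - h ga.
  by rewrite pairingB pairingZ mulrN.
have gy : generic y.
  by apply: generic_pos => ga; rewrite fy; have [] := he ga.
exists (cell y); split; first exact: Rg_cell.
  move=> i; rewrite ffunE /= pairingB pairingZ hrho; apply: floor_def.
  by rewrite add0r mulr1; apply/andP; split; lra.
move=> x gx hx ga; rewrite !ffunE.
have [_ Ny] := he ga.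
have {}Ny : N ga <= fl (val ga) y by rewrite floor_ge_int ltW // fy.
apply: le_trans Ny; rewrite -ltzD1 /N subrK floor_lt_int.
have xh : f (val ga) x <= h ga.
  rewrite /h !pairing_simple ler_sum // => i _.
  by rewrite ler_wpM2l ?simple_weight_ge0 // hrho ltW.
apply: lt_le_trans (_ : _ < (Num.ceil (h ga))%:~R) _; last by [].
(* A generic [x] takes no integer value, which excludes equality with the ceiling. *)
rewrite lt_neqAle (le_trans xh (ceil_ge _)) andbT.
apply/negP => /eqP xE; have := gx _ (posroot_root ga).
by rewrite xE intr_int.
Qed.

Lemma fundamental_alcoveE x :
  @fundamental_alcove _ _ dot Phi _ Delta x <-> region alcove0 x.
Proof. by split=> h a; have := h a; rewrite /alcove0 ffunE. Qed.

Lemma fundamental_polytopeE x :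
  fundamental_polytope dot Delta x <-> forall i : 'I_n, 0 < f Delta`_i x < 1.
Proof.
split=> [h i|h _ /(nthP 0)[i ii <-]].
  by have := h Delta`_i; rewrite /strip /= add0r; apply; rewrite mem_nth // size_tuple.
rewrite size_tuple in ii.
by have := h (Ordinal ii); rewrite /strip /= add0r.
Qed.

Lemma alcove_region lam w : affine_weyl dot Phi w ->
  Rg lam -> (exists x, region alcove0 x /\ region lam (w x)) ->
  @alcove _ _ dot Phi _ Delta w = [set x | region lam x]%classic.
Proof.
move=> Ww Rl [x [ax lx]]; have gx := region_generic ax.
have gwx := region_generic lx.
apply/seteqP; split=> z /=.
  move=> [y /fundamental_alcoveE ay <-]; have gy := region_generic ay.
  have := affine_weyl_same_region rPhi Ww (proj2 (same_cell gx gy) _).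
  have gwy := affine_weyl_generic rPhi Ww gy.
  rewrite (region_cell ax) (region_cell ay) => /(_ erefl) /(same_cell gwx gwy) e.
  by rewrite -(region_cell lx) e; apply: cell_region.
move=> lz; have gz := region_generic lz.
have [|y [gy xy <-]] := affine_weyl_preimage (x := x) rPhi Ww gz.
  by apply/(same_cell gwx gz); rewrite (region_cell lx) (region_cell lz).
exists y => //; apply/fundamental_alcoveE; move/(same_cell gx gy): xy.
by rewrite (region_cell ax) => ->; apply: cell_region.
Qed.

Lemma admittedE : exists top : vec, [/\ Rg top,
  forall i, top (FSetSub (simple_posroot i)) = 0 &
  forall lam, admitted dot lam <-> [/\ Rg lam, vle alcove0 lam & vle lam top]].
Proof.
have [t [Rt t0 tP]] := region_top.
have [a aP] := region_alcove0; have ga := region_generic aP.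
exists t; split=> // lam; split.
  move=> [w [Ww wP lamE]].
  have aw : @alcove _ _ dot Phi _ Delta w (w a).
    by exists a => //; apply/fundamental_alcoveE.
  have /fundamental_polytopeE Pw := wP _ aw.
  have lw : region lam (w a) by rewrite lamE in aw; apply: aw.
  split; first by exists (w a).
    move=> al; rewrite -(region_cell lw) !ffunE floor_ge0 pairing_simple.
    rewrite sumr_ge0 // => i _; rewrite mulr_ge0 ?simple_weight_ge0 //.
    by have /andP[/ltW] := Pw i.
  rewrite -(region_cell lw); apply: tP; first exact: region_generic lw.
  by move=> i; have /andP[] := Pw i.
move=> [Rl l0 lt]; have [x lx] := Rl; have gx := region_generic lx.
have [w Ww [gw wx]] := affine_weyl_transitive rPhi ga gx.
have lw : region lam (w a).
  by rewrite -(region_cell lx) -((same_cell gw gx).1 wx); apply: cell_region.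
have E := alcove_region Ww Rl (ex_intro _ a (conj aP lw)).
exists w; split=> //; rewrite E => z lz; apply/fundamental_polytopeE => i.
have := lz (FSetSub (simple_posroot i)).
(* Both ends of the interval vanish at the simple roots, which forces the same for [lam]. *)
have -> : lam (FSetSub (simple_posroot i)) = 0.
  have := l0 (FSetSub (simple_posroot i)); have := lt (FSetSub (simple_posroot i)).
  by rewrite t0 ffunE => h h'; apply/le_anti; rewrite h h'.
by rewrite /strip /= add0r.
Qed.

(** * Walls and pencils of hyperplanes *)

Lemma Rg_opp lam : Rg lam -> Rg (vneg lam).
Proof.
case=> x lx; exists (- x) => al; have := lx al.
rewrite /strip /= ffunE -!/(f _ _) pairingN subrK.
by rewrite !rmorphD rmorphN /= rmorph1; lra.
Qed.

Lemma pairing_separate al be : al <> be ->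
  exists v, f (val al) v = 0 /\ f (val be) v = 1.
Proof.
move=> nab.
have [a0 b0] := (root_nz rPhi (posroot_root al), root_nz rPhi (posroot_root be)).
(* The component of [be] orthogonal to [al]. It is nonzero because distinct positive roots of a
   reduced system are not proportional. *)
pose v := val be - (f (val al) (val be) / 2) *: val al.
have av : f (val al) v = 0 by rewrite pairingB pairingZ pairing_self //; lra.
have v0 : v != 0.
  apply/eqP => /eqP; rewrite subr_eq0 => /eqP beE.
  have := posroot_root be; rewrite {1}beE.
  move=> /(root_reduced rPhi (posroot_root al)) [e|e].
    by apply: nab; apply: val_inj; rewrite beE e scale1r.
  apply: (@posroot_not_opp (val al)); first exact: valP.
  by rewrite -scaleN1r -e -beE; apply: valP.
have bv : f (val be) v != 0.
  have vb : val be = v + (f (val al) (val be) / 2) *: val al by rewrite subrK.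
  have : dot v (val be) = dot v v.
    rewrite {1}vb linearDr /= dotZr; move: av; rewrite pairingE => /eqP.
    rewrite !mulf_eq0 invr_eq0 pnatr_eq0 (gt_eqF (dot_gt0 dot a0)) /=.
    by move=> /eqP ->; rewrite mulr0 addr0.
  rewrite pairingE => ->; rewrite !mulf_eq0 invr_eq0 pnatr_eq0.
  by rewrite !gt_eqF ?dot_gt0.
by exists ((f (val be) v)^-1 *: v); rewrite !pairingZ av mulr0 mulVf.
Qed.

Lemma segment_point A B x y al t : region A y -> region B x -> vle A B ->
  f (val al) y < t < f (val al) x -> exists z, f (val al) z = t /\
    forall ga, (A ga)%:~R < f (val ga) z < (B ga + 1)%:~R.
Proof.
move=> Ay Bx AB /andP[yt tx].
have d0 : 0 < f (val al) x - f (val al) y by lra.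
pose s := (t - f (val al) y) / (f (val al) x - f (val al) y).
have s0 : 0 < s by rewrite divr_gt0 // subr_gt0.
have s1 : s < 1 by rewrite ltr_pdivrMr // mul1r; lra.
have fz c : f c (y + s *: (x - y)) = f c y + s * (f c x - f c y).
  by rewrite (pairingD _ _ y) pairingZ pairingB.
exists (y + s *: (x - y)); split; first by rewrite fz divfK ?gt_eqF //; ring.
move=> ga; rewrite fz; have := Ay ga; have := Bx ga; rewrite /strip /= -!/(f _ _).
move=> /andP[h1 h2] /andP[h3 h4].
have h5 : (A ga)%:~R <= (B ga)%:~R :> R by rewrite ler_int.
have h6 : (A ga + 1)%:~R <= (B ga + 1)%:~R :> R by rewrite ler_int lerD2r.
by apply/andP; split; nra.
Qed.

(** Nudging [z] towards the generic [x] gives the region [C]. It is below the level [j] of [al],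
    unlike [B], and above the level [k] of [be], unlike [A]. *)
Lemma intermediate_region A B x z al be j k :
  generic x -> (forall ga, (A ga)%:~R < f (val ga) z < (B ga + 1)%:~R) ->
  j <= B al -> f (val al) z < j%:~R -> A be < k -> k%:~R < f (val be) z ->
  exists C, [/\ Rg C, vle A C, vle C B, C <> A & C <> B].
Proof.
move=> gx zAB jB zj Ak kz.
have s1 : small (fun e => forall ga,
    (A ga)%:~R < f (val ga) z + e * f (val ga) (x - z) /\
    f (val ga) z + e * f (val ga) (x - z) < (B ga + 1)%:~R).
  apply: small_forall => ga; have /andP[] := zAB ga.
  by move=> h1 h2; apply: small_and; [apply: small_gt|apply: small_lt].
have s2 := small_and (small_lt (f (val al) (x - z)) zj)
  (small_gt (f (val be) (x - z)) kz).
have [e e0 [h [[ej ek] ge]]] :=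
  small_ex (small_and s1 (small_and s2 (generic_perturb z gx))).
have fE c : f c (z + e *: (x - z)) = f c z + e * f c (x - z).
  by rewrite (pairingD _ _ z) pairingZ.
exists (cell (z + e *: (x - z))); split; first exact: Rg_cell.
- by move=> ga; rewrite ffunE fE floor_ge_int; have [/ltW] := h ga.
- by move=> ga; rewrite ffunE fE -ltzD1 floor_lt_int; have [] := h ga.
- move=> /ffunP/(_ be); rewrite ffunE fE => e'.
  by move/ltW: ek; rewrite -floor_ge_int e' leNgt Ak.
- move=> /ffunP/(_ al); rewrite ffunE fE => e'.
  by move: ej; rewrite -floor_lt_int e' ltNge jB.
Qed.

(* If all the hyperplanes separating [A] from [B] were crossed at the same
   time by every segment, moving an endpoint would separate two of them. *)
Lemma Rg_between A B : Rg A -> Rg B -> vle A B -> A <> B ->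
  (forall al, B <> vinc A al) ->
  exists C, [/\ Rg C, vle A C, vle C B, C <> A & C <> B].
Proof.
move=> [y Ay] [x Bx] AB nAB nB; have [al ABal] := vle_neq AB nAB.
have gx := region_generic Bx.
have /andP[_ yal] := Ay al; have /andP[xal _] := Bx al.
rewrite -/(f _ _) in yal xal.
have [ABal1|] := ltP (A al + 1) (B al).
  have [|z [zal zAB]] :=
    @segment_point A B x y al ((B al)%:~R - 1 / 2) Ay Bx AB.
    have : (A al + 1)%:~R <= (B al - 1)%:~R :> R by rewrite ler_int; lia.
    by rewrite rmorphB /= => h; apply/andP; split; lra.
  apply: (@intermediate_region A B x z al al (B al) (B al - 1)) => //.
  - by rewrite zal; lra.
  - by lia.
  - by rewrite zal rmorphB /=; lra.
move=> BAal; have BE : B al = A al + 1 by apply/le_anti; rewrite BAal lezD1.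
have [be [neq ABbe]] : exists be, al <> be /\ A be < B be.
  apply: contrapT => h; apply: (nB al); apply/ffunP => be; rewrite ffunE.
  case: eqP => [->|/nesym neq]; first by rewrite BE.
  rewrite addr0; apply/le_anti; rewrite AB andbT leNgt; apply/negP => h'.
  by apply: h; exists be.
have [v1 [v1al v1be]] := pairing_separate neq.
have [v2 [v2be v2al]] := pairing_separate (nesym neq).
(* Along [v] the form of [al] falls and that of [be] rises. Starting from a point [z] on the
   hyperplane of [al], the direction of the move depends on the side of the hyperplane of [be] on
   which [z] lies. *)
pose v := v1 - v2.
have val_ : f (val al) v = -1 by rewrite pairingB v1al v2al sub0r.
have vbe : f (val be) v = 1 by rewrite pairingB v1be v2be subr0.
have [|z [zal zAB]] := @segment_point A B x y al (B al)%:~R Ay Bx AB.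
  by rewrite BE yal -BE.
have near_z (s : R) : small (fun e => forall ga,
    (A ga)%:~R < f (val ga) z + e * (s * f (val ga) v) /\
    f (val ga) z + e * (s * f (val ga) v) < (B ga + 1)%:~R).
  apply: small_forall => ga; have /andP[] := zAB ga.
  by move=> h1 h2; apply: small_and; [apply: small_gt|apply: small_lt].
have fE e s c : f c (z + e *: (s *: v)) = f c z + e * (s * f c v).
  by rewrite (pairingD _ _ z) !pairingZ.
have [h|h] := leP (B be)%:~R (f (val be) z).
  have [e e0 he] := small_ex (near_z 1).
  apply: (@intermediate_region A B x (z + e *: (1 *: v)) al be (B al) (B be)) => //.
  - by move=> ga; rewrite fE; apply/andP/he.
  - by rewrite fE val_ zal; lra.
  - by rewrite fE vbe; lra.
have [e e0 [he he']] :=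
  small_ex (small_and (near_z (-1)) (small_lt (-1 * f (val be) v) h)).
apply: (@intermediate_region A B x (z + e *: (-1 *: v)) be al (B be) (B al)) => //.
- by move=> ga; rewrite fE; apply/andP/he.
- by rewrite fE.
- by rewrite fE val_ zal; lra.
Qed.

(** Replace [A] by a region strictly between [A] and [B] until a single wall separates the two. *)
Lemma Rg_chain A B : Rg A -> Rg B -> vle A B -> A <> B ->
  exists2 al, Rg (vdec B al) & vle A (vdec B al).
Proof.
move eqN: (vdist A B) => N; elim/ltn_ind: N A eqN => N IHN A eqN RA RB AB nAB.
have [[al BE]|nB] := pselect (exists al, B = vinc A al).
  have AE : vdec B al = A by rewrite BE; apply/ffunP => ga; rewrite !ffunE addrK.
  by exists al; rewrite AE //; apply: vle_refl.
have [|C [RC AC CB nCA nCB]] := Rg_between RA RB AB nAB.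
  by move=> al BE; apply: nB; exists al.
have [i ACi] := vle_neq AC (nesym nCA).
have lt := vdist_ltl AC CB ACi; rewrite eqN in lt.
have [al Ral Cal] := IHN _ lt _ erefl RC RB CB nCB.
by exists al => //; apply: vle_trans Cal.
Qed.

(** The two regions differ only at [al], so the segment between them meets the wall in a point of
    its relative interior. *)
Lemma wall_point w al x : Rg (vdec w al) -> region w x ->
  exists q, f (val al) q = (w al)%:~R /\
    forall c, c \in Phi -> c <> val al -> c <> - val al ->
      f c q \isn't a Num.int /\ fl c q = fl c x.
Proof.
move=> [y yw] xw; have := yw al; have := xw al.
rewrite /strip /= !ffunE eqxx subrK -!/(f _ _) => /andP[h1 _] /andP[_ h2].
have [|q [qal qw]] := segment_point yw xw (vdec_le w al) (t := (w al)%:~R) (al := al).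
  by rewrite h1 h2.
exists q; split=> //.
have key ga : ga <> al -> (w ga)%:~R < f (val ga) q < (w ga + 1)%:~R.
  by move=> /eqP/negPf nga; have := qw ga; rewrite ffunE nga subr0.
have gx := region_generic xw.
move=> c /root_sign[Pc|Pc] nc nc'.
  have h : FSetSub Pc <> al by move=> e; apply: nc; rewrite -e.
  have /= hq := key _ h; split; first exact: nonint_between hq.
  rewrite (floor_def (m := w (FSetSub Pc))); last by have /andP[/ltW ->] := hq.
  by have /ffunP/(_ (FSetSub Pc)) := region_cell xw; rewrite ffunE.
have h : FSetSub Pc <> al by move=> e; apply: nc'; rewrite -e opprK.
have /= hq := key _ h; have cq := nonint_between hq.
have [Pnc _] := posrootP _ Pc.
have e1 : fl (- c) q = w (FSetSub Pc).
  by rewrite (floor_def (m := w (FSetSub Pc))) //; have /andP[/ltW ->] := hq.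
have e2 : fl (- c) x = w (FSetSub Pc).
  by have /ffunP/(_ (FSetSub Pc)) := region_cell xw; rewrite ffunE.
have e3 : fl c x = - w (FSetSub Pc) - 1.
  by have := floorN_generic gx Pnc; rewrite opprK e2.
split; first by rewrite -(opprK c) pairing_opp rpredN.
rewrite e3; apply: floor_def; move: hq; rewrite pairing_opp subrK.
by rewrite !rmorphB !rmorphN !rmorphD /= !rmorph1; lra.
Qed.

Lemma refl_opp_self al : refl (val al) 0 (val al) = - val al.
Proof.
rewrite /affine_reflection -/(f (val al) _).
rewrite (pairing_self dot (root_nz rPhi (posroot_root al))).
by rewrite subr0 scaler_nat mulr2n opprD addNKr.
Qed.

(** The reflection fixes the point [q] of the wall, where all roots but [al] and its negative have
    the same floors as at [x]. *)
Lemma adjacent_reflection w al x c : Rg (vdec w al) -> region w x ->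
  c \in Phi -> c <> val al -> c <> - val al ->
  fl c (refl (val al) (w al) x) = fl c x.
Proof.
move=> Ry xw Pc nc nc'; have [q [qal qP]] := wall_point Ry xw.
have a0 := root_nz rPhi (posroot_root al).
have sK := affine_reflectionK dot 0 a0.
have sq : refl (val al) (w al) q = q.
  by rewrite /affine_reflection -/(f (val al) q) qal subrr scale0r subr0.
have [|||_ e1] := qP (refl (val al) 0 c).
- exact: root_reflection.
- by move=> e; apply: nc'; rewrite -(sK c) e refl_opp_self.
- by move=> e; apply: nc; rewrite -(sK c) e -refl_opp_self sK.
have [_ <-] := qP c Pc nc nc'.
by rewrite -[in RHS]sq !(floor_refl rPhi) ?e1.
Qed.

(* The hyperplane [f c = j] contains the intersection of the walls
   [f (val al) = w al] and [f (val be) = w be]. *)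
Definition pencil w al be c j (s t : R) : Prop :=
  (forall x, f c x = s * f (val al) x + t * f (val be) x) /\
  j%:~R = s * (w al)%:~R + t * (w be)%:~R.

Definition in_pencil w al be c j := exists s t, pencil w al be c j s t.

Lemma pencilC w al be c j s t :
  pencil w al be c j s t -> pencil w be al c j t s.
Proof. by case=> h1 h2; split=> [x|]; rewrite addrC. Qed.

(** Distinct positive roots give independent forms. In particular a root has at most one hyperplane
    in the pencil. *)
Lemma pencil_inj w al be c j j' s s' t t' : al <> be ->
  pencil w al be c j s t -> pencil w al be c j' s' t' ->
  [/\ j = j', s = s' & t = t'].
Proof.
move=> nab [h1 h2] [h1' h2'].
have [v1 [v1al v1be]] := pairing_separate nab.
have [v2 [v2be v2al]] := pairing_separate (nesym nab).
have es : s = s' by have := h1' v2; rewrite h1 v2be v2al; lra.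
have et : t = t' by have := h1' v1; rewrite h1 v1be v1al; lra.
split=> //; apply: (@intr_inj R).
by rewrite h2 h2' es et.
Qed.

(** Reflecting in the first wall fixes the axis of the pencil and changes only the coefficient of
    [al]. *)
Lemma pencil_refl w al be c j s t : c \in Phi ->
  pencil w al be c j s t -> exists j' s',
    pencil w al be (refl (val al) 0 c) j' s' t /\
    j'%:~R = j%:~R - (w al)%:~R * f c (val al).
Proof.
move=> Pc [h1 h2]; have a0 := root_nz rPhi (posroot_root al).
have jint : j%:~R - (w al)%:~R * f c (val al) \is a Num.int.
  by rewrite rpredB ?rpredM ?intr_int ?(pairing_int rPhi).
exists (Num.floor (j%:~R - (w al)%:~R * f c (val al))), (- s - t * f (val be) (val al)).
rewrite floorK //; split=> //; split=> [x|].
  by rewrite pairing_reflection // !h1 pairing_self //; ring.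
by rewrite floorK // h2 h1 pairing_self //; ring.
Qed.

(* No hyperplane of a pencil spanned by two walls of [w] cuts [w], so the two
   walls play the role of a system of simple roots for the pencil. *)
Lemma pencil_sign w al be c j s t : al <> be -> Rg w ->
  Rg (vdec w al) -> Rg (vdec w be) -> c \in Phi ->
  pencil w al be c j s t -> 0 < s -> t < 0 -> False.
Proof.
move=> nab [x xw] Ral Rbe Pc [h1 h2] s0 t0.
have [v1 [v1al v1be]] := pairing_separate nab.
have [v2 [v2be v2al]] := pairing_separate (nesym nab).
have nc ga (e : R) : (forall y, f c y = e * f (val ga) y) ->
    ga = al \/ ga = be -> False.
  move=> h [] E; move: (h v1) (h v2); rewrite !h1 E v1al v1be v2al v2be; lra.
have nE ga : ga = al \/ ga = be -> c <> val ga /\ c <> - val ga.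
  move=> hga; split=> E.
    by apply: (nc ga 1) => // y; rewrite E mul1r.
  by apply: (nc ga (-1)) => // y; rewrite E pairing_opp mulN1r.
have [nca nca'] := nE al (or_introl erefl).
have [ncb ncb'] := nE be (or_intror erefl).
have nvab : val al <> val be by move=> /val_inj.
have nvab' : val al <> - val be.
  move=> E; apply: (@posroot_not_opp (val be)); first exact: valP.
  by rewrite -E; apply: valP.
have [q1 [q1al /[dup] q1P /(_ _ Pc nca nca') [cq1 e1]]] := wall_point Ral xw.
have [q2 [q2be /[dup] q2P /(_ _ Pc ncb ncb') [cq2 e2]]] := wall_point Rbe xw.
have flx ga : fl (val ga) x = w ga.
  by have /ffunP/(_ ga) := region_cell xw; rewrite ffunE.
have gtw ga q : f (val ga) q \isn't a Num.int ->
    fl (val ga) q = w ga -> (w ga)%:~R < f (val ga) q.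
  move=> ni e; have /andP[+ _] := floor_itv (f (val ga) q); rewrite e le_eqVlt.
  by case: eqP => //= E; move: ni; rewrite -E intr_int.
have b1 : (w be)%:~R < f (val be) q1.
  have [||h h'] := q1P _ (posroot_root be); [exact: nesym| |].
    by move=> E; apply: nvab'; rewrite E opprK.
  by apply: gtw => //; rewrite h'.
have a2 : (w al)%:~R < f (val al) q2.
  by have [h h'] := q2P _ (posroot_root al) nvab nvab'; apply: gtw => //; rewrite h'.
(* The opposite signs put [q1], on the first wall, below the hyperplane and [q2], on the second,
   above it; yet both have the floor of [x] at [c]. *)
have c1 : fl c q1 < j.
  by rewrite floor_lt_int h1 h2 q1al; nra.
have c2 : j <= fl c q2.
  by rewrite floor_ge_int h1 h2 q2be; nra.
by move: c1 c2; rewrite e1 e2 leNgt => ->.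
Qed.

(* Near points are separated from [x0] by hyperplanes of the pencil only; the
   group generated by the two reflections preserves them. *)
Definition near_region w al be x0 x : Prop := generic x /\
  forall c j, c \in Phi -> ~ in_pencil w al be c j ->
    (j <= fl c x) = (j <= fl c x0).

Lemma near_regionC w al be x0 x :
  near_region w al be x0 x -> near_region w be al x0 x.
Proof.
move=> [gx h]; split=> // c j Pc np; apply: h => // -[s [t /pencilC p]].
by apply: np; exists t, s.
Qed.

(** The reflection permutes the hyperplanes outside the pencil, and none of these separates [x0]
    from its mirror image. *)
Lemma near_refl w al be x0 x : Rg (vdec w al) -> region w x0 ->
  near_region w al be x0 x -> near_region w al be x0 (refl (val al) (w al) x).
Proof.
move=> Ral x0w [gx h]; have a0 := root_nz rPhi (posroot_root al).
have sK := affine_reflectionK dot 0 a0.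
split=> [|c j Pc np]; first exact: generic_refl.
have Psc := root_reflection rPhi (posroot_root al) Pc.
set m := Num.floor ((w al)%:~R * f c (val al)).
have mE : m%:~R = (w al)%:~R * f c (val al).
  by rewrite floorK // rpredM ?intr_int ?(pairing_int rPhi).
have npsc : ~ in_pencil w al be (refl (val al) 0 c) (j - m).
  move=> [s [t /(pencil_refl Psc) [j' [s' []]]]]; rewrite sK => p.
  rewrite pairing_reflection // pairing_self // rmorphB /= mE => j'E.
  apply: np; exists s', t; suff -> : j = j' by [].
  by apply: (@intr_inj R); rewrite j'E; ring.
rewrite (floor_refl rPhi) // -/m -lerBlDr (h _ _ Psc npsc) lerBlDr.
rewrite -(floor_refl rPhi) //.
have gx0 := region_generic x0w.
have flal : fl (val al) x0 = w al.
  by have /ffunP/(_ al) := region_cell x0w; rewrite ffunE.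
have flsal : fl (val al) (refl (val al) (w al) x0) = w al - 1.
  apply: floor_def; rewrite pairing_affine_reflection pairing_self // subrK.
  have := x0w al; rewrite /strip /= -/(f _ _) !rmorphD rmorphN /= rmorph1.
  by move=> /andP[h1 h2]; apply/andP; split; lra.
have [Ec|nc] := pselect (c = val al).
  have nj : j <> w al.
    move=> E; apply: np; exists 1, 0; rewrite Ec E; split=> [y|]; ring.
  by rewrite Ec flal flsal; lia.
have [Ec|nc'] := pselect (c = - val al).
  have nj : j <> - w al.
    move=> E; apply: np; exists (-1), 0; rewrite Ec E.
    by split=> [y|]; rewrite ?pairing_opp ?rmorphN /=; ring.
  have Pal := posroot_root al.
  have gsx0 : generic (refl (val al) (w al) x0) by apply: generic_refl.
  by rewrite Ec (floorN_generic gx0 Pal) (floorN_generic gsx0 Pal) flal flsal; lia.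
by rewrite (adjacent_reflection Ral x0w).
Qed.

(** Nonnegative [s] and [t] single out the positive roots of the pencil, the two walls being
    simple. *)
Definition above w al be c x : Prop := exists j s t,
  [/\ 0 <= s, 0 <= t, pencil w al be c j s t & j%:~R < f c x].

Definition height_above w al be x : nat :=
  (\sum_(c <- Phi) `[< above w al be c x >])%N.

Lemma aboveC w al be c x : above w al be c x = above w be al c x.
Proof.
by apply/propext; split=> -[j [s [t [s0 t0 /pencilC p h]]]]; exists j, t, s.
Qed.

Lemma height_aboveC w al be x : height_above w al be x = height_above w be al x.
Proof. by apply: eq_bigr => c _; rewrite aboveC. Qed.

(** As for a simple reflection: by [pencil_sign], positive roots of the pencil other than [al] go to
    positive ones, while the wall of [al] itself ceases to lie below the point. *)
Lemma height_refl w al be x : al <> be -> Rg w ->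
  Rg (vdec w al) -> Rg (vdec w be) -> (w al)%:~R < f (val al) x ->
  (height_above w al be (refl (val al) (w al) x) < height_above w al be x)%N.
Proof.
move=> nab Rw Ral Rbe wx; have a0 := root_nz rPhi (posroot_root al).
have Pal := posroot_root al; pose s0 := refl (val al) 0.
have sK : involutive s0 := affine_reflectionK dot 0 a0.
have -> : height_above w al be x =
    (\sum_(c <- Phi) `[< above w al be (s0 c) x >])%N.
  by rewrite /height_above -(perm_big _ (perm_refl rPhi Pal)) big_map.
have imp c : c \in Phi -> above w al be c (refl (val al) (w al) x) ->
    above w al be (s0 c) x.
  move=> Pc [j [s [t [sge tge p h]]]].
  have [j' [s' [p' j'E]]] := pencil_refl Pc p.
  have lt' : j'%:~R < f (s0 c) x.
    by move: h; rewrite pairing_affine_reflectionE // -/(s0 c) j'E; lra.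
  exists j', s', t; split=> //; move: tge; rewrite le_eqVlt => /orP[/eqP t0|t0].
    case: p => h1 h2; move: h; rewrite h2 h1 -t0 !mul0r !addr0.
    by rewrite pairing_affine_reflection pairing_self //; nra.
  rewrite leNgt; apply/negP => s'0.
  apply: (@pencil_sign w be al (s0 c) j' t s') => //; first exact: nesym.
    exact: root_reflection.
  exact: pencilC.
have Pnal : - val al \in Phi by apply: (root_opp rPhi).
(* After the reindexing, the summand at [- val al] is that of [val al] on the right, hence 1, and it
   is 0 on the left. *)
rewrite /height_above (bigD1_seq (- val al)) ?fset_uniq //=.
rewrite [ltnRHS](bigD1_seq (- val al)) ?fset_uniq //=.
have -> : s0 (- val al) = val al by rewrite -refl_opp_self sK.
rewrite -addSn leq_add //.
  have -> : `[< above w al be (val al) x >] = true.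
    by apply/asboolP; exists (w al), 1, 0; split=> //; split=> [y|]; ring.
  rewrite asboolF // => -[j [s [t [sge tge [h1 h2] _]]]].
  have [v2 [v2be v2al]] := pairing_separate (nesym nab).
  by have := h1 v2; rewrite pairing_opp v2al v2be; lra.
rewrite big_seq_cond [leqRHS]big_seq_cond leq_sum // => c /andP[Pc _].
by case: asboolP => // /(imp _ Pc) /asboolT ->.
Qed.

Lemma positive_combination (s t u v : R) : 0 < u -> 0 < v ->
  0 < s * u + t * v -> (0 < s -> t < 0 -> False) ->
  (0 < t -> s < 0 -> False) -> [/\ 0 <= s, 0 <= t & 0 < s \/ 0 < t].
Proof.
move=> u0 v0 h n1 n2; have [s0|s0|s0] := ltgtP 0 s.
- split=> //; last by left.
  by rewrite leNgt; apply/negP; apply: n1.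
- have [t0|t0] := ltP 0 t; first by case: (n2 t0 s0).
  by move: h; rewrite ltNge; case/negP; nra.
- have t0 : 0 < t by move: h; rewrite -s0 mul0r add0r pmulr_lgt0.
  by split; [|apply: ltW|right].
Qed.

(* Reflecting in a wall that lies below the point removes exactly that wall
   from the hyperplanes of the pencil below it, so the process stops at a point
   below all of them. This avoids proving that the two walls meet on the closure
   of [w]. *)
Lemma opposite_point w al be x0 : al <> be -> region w x0 ->
  Rg (vdec w al) -> Rg (vdec w be) ->
  exists x, [/\ near_region w al be x0 x, f (val al) x < (w al)%:~R &
    f (val be) x < (w be)%:~R].
Proof.
move=> nab x0w Ral Rbe; have Rw : Rg w by exists x0.
have gx0 := region_generic x0w.
have : near_region w al be x0 x0 by split.
move: {2}x0 => x; move eqN: (height_above w al be x) => N.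
elim/ltn_ind: N x eqN => N IHN x eqN nx.
have neq ga : f (val ga) x <> (w ga)%:~R.
  by move=> e; have := nx.1 _ (posroot_root ga); rewrite e intr_int.
have [h|] := ltP (f (val al) x) (w al)%:~R; last first.
  rewrite le_eqVlt eq_sym (introF eqP (neq al)) /= => h.
  have := height_refl nab Rw Ral Rbe h; rewrite eqN => lt.
  by apply: (IHN _ lt _ erefl); apply: near_refl.
have [h'|] := ltP (f (val be) x) (w be)%:~R; first by exists x.
rewrite le_eqVlt eq_sym (introF eqP (neq be)) /= => h'.
have := height_refl (nesym nab) Rw Rbe Ral h'.
rewrite -!(height_aboveC w al) eqN => lt.
by apply: (IHN _ lt _ erefl); apply/near_regionC/near_refl => //; apply: near_regionC.
Qed.

(** [m] is the cell of the opposite point. Outside the pencil it agrees with [w]; inside, the form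
    is a nonnegative combination of those of the two walls, so a point on the same side of both has
    its side forced. *)
Lemma Rg_dihedral w al be : al <> be ->
  Rg w -> Rg (vdec w al) -> Rg (vdec w be) ->
  exists m, [/\ Rg m, m al = w al - 1, m be = w be - 1 &
    forall ga, m ga = w ga \/ (m ga = w ga - 1 /\ forall p : vec, Rg p ->
      (p al < w al -> p be < w be -> p ga < w ga) /\
      (w al <= p al -> w be <= p be -> w ga <= p ga))].
Proof.
move=> nab Rw Ral Rbe; have [x0 x0w] := Rw.
have [x [[gx nx] xal xbe]] := opposite_point nab x0w Ral Rbe.
have gx0 := region_generic x0w.
have flx0 ga : fl (val ga) x0 = w ga.
  by have /ffunP/(_ ga) := region_cell x0w; rewrite ffunE.
have [rho hrho] := rho_exists.
have rho0 ga := pairing_rho_gt0 ga hrho.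
have key ga : cell x ga = w ga \/ (cell x ga = w ga - 1 /\ forall p : vec, Rg p ->
      (p al < w al -> p be < w be -> p ga < w ga) /\
      (w al <= p al -> w be <= p be -> w ga <= p ga)).
  rewrite ffunE; have Pga := posroot_root ga.
  have [[j [s [t pj]]]|np] :=
    pselect (exists j, in_pencil w al be (val ga) j); last first.
    left; apply/le_anti; rewrite -{1}(flx0 ga) -(nx _ (fl (val ga) x)) ?lexx //=.
      by rewrite (nx _ (w ga)) ?flx0 // => p; apply: np; exists (w ga).
    by move=> p; apply: np; exists (fl (val ga) x).
  have np j' : j' <> j -> ~ in_pencil w al be (val ga) j'.
    by move=> ne [s' [t' /(pencil_inj nab pj) [/esym]]].
  have [h1 h2] := pj.
  (* All three forms are positive at rho, and mixed signs are excluded. *)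
  have [s0 t0 st0] : [/\ 0 <= s, 0 <= t & 0 < s \/ 0 < t].
    apply: (positive_combination (rho0 al) (rho0 be)); first by rewrite -h1.
      exact: pencil_sign pj.
    by apply: (@pencil_sign w be al (val ga) j) => //; [apply: nesym|apply: pencilC].
  have low y : generic y -> fl (val al) y < w al -> fl (val be) y < w be ->
      fl (val ga) y < j.
    move=> gy; rewrite !floor_lt_int h1 h2 => ya yb.
    by case: st0 => ?; nra.
  have high y : generic y -> w al <= fl (val al) y -> w be <= fl (val be) y ->
      j <= fl (val ga) y.
    by move=> gy; rewrite !floor_ge_int h1 h2 => ya yb; nra.
  have xj : fl (val ga) x < j by apply: low => //; rewrite floor_lt_int.
  have jw : j <= w ga by rewrite -flx0; apply: high; rewrite // flx0.
  (* Only the level [j] of [ga] belongs to the pencil, so [x] and [x0] agree about the levels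
     [j - 1] and [j + 1], which pins both floors. *)
  have wj : w ga = j.
    apply/le_anti; rewrite jw andbT -ltzD1 ltNge.
    have := nx (val ga) (j + 1) Pga; rewrite flx0 => <-; last by apply: np; lia.
    by rewrite -ltNge; lia.
  have xj' : fl (val ga) x = j - 1.
    have : j - 1 <= fl (val ga) x.
      by rewrite nx ?flx0 ?wj; [lia| |apply: np; lia].
    by move: xj; lia.
  right; rewrite wj; split=> // p /RgP[y gy <-]; rewrite !ffunE.
  by split; [apply: low|apply: high].
exists (cell x); split=> //; first exact: Rg_cell.
- case: (key al) => [|[]//]; rewrite ffunE => e.
  by move: xal; rewrite -floor_lt_int e ltxx.
- case: (key be) => [|[]//]; rewrite ffunE => e.
  by move: xbe; rewrite -floor_lt_int e ltxx.
Qed.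

Lemma Rg_coxeter : coxeter_regions Rg.
Proof. by split; [apply: Rg_opp|apply: Rg_chain|apply: Rg_dihedral]. Qed.

End Shi.

(** * Irreducible components *)

Section ZariskiLines.
Context (R : realType) (I : finType).
Implicit Types (x y : {ffun I -> R}) (S D : set {ffun I -> R}).
Implicit Types (P Q : set {mpoly R[#|I|]}).
Local Open Scope classical_set_scope.

Lemma mpoly_line k (p : {mpoly R[k]}) (x d : 'I_k -> R) :
  exists q : {poly R}, forall t, q.[t] = p.@[fun i => x i + t * d i].
Proof.
exists (\sum_(m <- msupp p) (p@_m)%:P * \prod_i ((x i)%:P + d i *: 'X) ^+ m i).
move=> t; rewrite mevalE horner_sum; apply: eq_bigr => m _.
rewrite hornerM hornerC horner_prod; congr (_ * _); apply: eq_bigr => i _.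
by rewrite horner_exp hornerD hornerC hornerZ hornerX mulrC.
Qed.

Lemma poly_eq0_horner (p : {poly R}) : (forall t, p.[t] = 0) -> p = 0.
Proof.
move=> h; pose s : seq R := [seq i%:R | i <- iota 0 (size p)].
apply: (@roots_geq_poly_eq0 _ p s).
- by apply/allP => t _; apply/rootP/h.
- by rewrite map_inj_uniq ?iota_uniq //; apply: mulrIn; apply: oner_neq0.
- by rewrite size_map size_iota.
Qed.

(** Equations [p] and [q] failing at [x] and at [y] restrict to nonzero polynomials on the line
    through both points, yet their product vanishes on that line. *)
Lemma line_closed_irreducible S : S !=set0 ->
  (forall x y t, S x -> S y -> S [ffun i => x i + t * (y i - x i)]) ->
  zariski_irreducible S.
Proof.
move=> S0 Sline; split=> // P Q SPQ; apply: contrapT => /not_orP[nP nQ].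
have ex (P' : set {mpoly R[#|I|]}) : ~ S `<=` zero_locus P' ->
    exists x p, [/\ S x, P' p & p.@[fun j => x (enum_val j)] <> 0].
  move=> nP'; apply: contrapT => h; apply: nP' => x Sx p Pp.
  by apply: contrapT => px; apply: h; exists x, p.
have [x [p [Sx Pp px]]] := ex _ nP; have [y [q [Sy Qq qy]]] := ex _ nQ.
pose d (j : 'I_#|I|) := y (enum_val j) - x (enum_val j) : R.
have [u uE] := mpoly_line p (fun j => x (enum_val j)) d.
have [v vE] := mpoly_line q (fun j => x (enum_val j)) d.
have : u * v = 0.
  apply: poly_eq0_horner => t; rewrite hornerM uE vE.
  have zE (r : {mpoly R[#|I|]}) : r.@[fun j => x (enum_val j) + t * d j] =
      r.@[fun j => [ffun i => x i + t * (y i - x i)] (enum_val j)].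
    by apply: meval_eq => j; rewrite ffunE.
  rewrite !zE; case: (SPQ _ (Sline x y t Sx Sy)) => h.
    by rewrite (h p Pp) mul0r.
  by rewrite (h q Qq) mulr0.
move/eqP; rewrite mulf_eq0 => /orP[] /eqP E.
  apply: px; have := uE 0; rewrite E horner0 => ->.
  by apply: meval_eq => j; rewrite mul0r addr0.
apply: qy; have := vE 1; rewrite E horner0 => ->.
by apply: meval_eq => j; rewrite mul1r /d addrC subrK.
Qed.

Lemma zero_locusU P Q : exists P', zero_locus P `|` zero_locus Q = zero_locus P'.
Proof.
exists [set r | exists p q, [/\ P p, Q q & r = p * q]].
apply/seteqP; split=> x /=.
  move=> h r [p [q [Pp Qq ->]]]; rewrite mevalM.
  by case: h => h; [rewrite (h _ Pp) mul0r|rewrite (h _ Qq) mulr0].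
move=> h; apply: contrapT => /not_orP[nP nQ].
have ex (P' : set {mpoly R[#|I|]}) : ~ zero_locus P' x ->
    exists2 p, P' p & p.@[fun j => x (enum_val j)] <> 0.
  move=> nP'; apply: contrapT => h'; apply: nP' => p Pp.
  by apply: contrapT => px; apply: h'; exists p.
have [p Pp px] := ex _ nP; have [q Qq qx] := ex _ nQ.
have /eqP := h _ (ex_intro _ p (ex_intro _ q (And3 Pp Qq erefl))).
by rewrite mevalM mulf_eq0 => /orP[] /eqP.
Qed.

Lemma irreducible_finite_cover (T : eqType) (s : seq T) (Z : T -> set {ffun I -> R}) D :
  (forall k, exists P, Z k = zero_locus P) -> zariski_irreducible D ->
  (forall x, D x -> exists2 k, k \in s & Z k x) -> exists2 k, k \in s & D `<=` Z k.
Proof.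
move=> Zcl [D0 Dirr] Ds.
have Ucl (r : seq T) : exists P, [set x | exists2 k, k \in r & Z k x] = zero_locus P.
  elim: r => [|k r [P PE]].
    exists [set 1]; apply/seteqP; split=> x /=; first by case.
    by move=> /(_ 1 erefl) /eqP; rewrite meval1 oner_eq0.
  have [Q QE] := Zcl k; have [P' P'E] := zero_locusU Q P.
  exists P'; rewrite -P'E -QE -PE; apply/seteqP; split=> x /=.
    by move=> [l]; rewrite inE => /predU1P[->|lr] Zl; [left|right; exists l].
  by move=> [Zk|[l lr Zl]];
    [exists k; rewrite ?mem_head|exists l; rewrite ?inE ?lr ?orbT].
elim: s Ds => [|k s IHs] Ds; first by have [x /Ds[]] := D0.
have [P PE] := Zcl k; have [Q QE] := Ucl s.
have [|h|h] := Dirr P Q.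
- move=> x /Ds[l]; rewrite inE => /predU1P[->|ls] Zl.
    by left; rewrite -PE.
  by right; rewrite -QE; exists l.
- by exists k; rewrite ?mem_head ?PE.
have [x Dx|l ls Dl] := IHs; first by have := h x Dx; rewrite -QE.
by exists l; rewrite // inE ls orbT.
Qed.

(** * Components of a finite union of affine graphs *)

Context (n : nat) (c : I -> 'I_n -> R) (h : 'I_n -> I).
Implicit Types (lam mu : {ffun I -> int}).

Definition graph lam : set {ffun I -> R} :=
  [set x : {ffun I -> R} | forall a, x a = \sum_(i < n) c a i * x (h i) + (lam a)%:~R].

Lemma graph_closed lam : exists P, graph lam = zero_locus P.
Proof.
pose p a : {mpoly R[#|I|]} := 'X_(enum_rank a) -
  \sum_(i < n) c a i *: 'X_(enum_rank (h i)) - ((lam a)%:~R)%:MP.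
have pE a x : (p a).@[fun j => x (enum_val j)] =
    x a - (\sum_(i < n) c a i * x (h i) + (lam a)%:~R).
  rewrite /p !mevalB mevalC mevalXU enum_rankK opprD addrA; congr (_ - _ - _).
  rewrite raddf_sum /=; apply: eq_bigr => i _.
  by rewrite mevalZ mevalXU enum_rankK.
exists [set q | exists a, q = p a]; apply/seteqP; split=> x /=.
  by move=> gx q [a ->]; rewrite pE gx subrr.
move=> zx a; have := zx _ (ex_intro _ a erefl); rewrite pE => /eqP.
by rewrite subr_eq0 => /eqP.
Qed.

Lemma graph_base lam : (forall i, lam (h i) = 0) ->
  graph lam [ffun a => (lam a)%:~R].
Proof.
move=> l0 a; rewrite ffunE big1 ?add0r // => i _.
by rewrite ffunE l0 mulr0.
Qed.

(** The point of the graph with zero coordinates at all [h i] has coordinates [lam]. *)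
Lemma graph_sub_eq lam mu : (forall i, lam (h i) = 0) ->
  graph lam `<=` graph mu -> lam = mu.
Proof.
move=> l0 /(_ _ (graph_base l0)) g; apply/ffunP => a; apply: (@intr_inj R).
have := g a; rewrite ffunE big1 ?add0r // => i _.
by rewrite ffunE l0 mulr0.
Qed.

Lemma graph_irreducible lam : (forall i, lam (h i) = 0) ->
  zariski_irreducible (graph lam).
Proof.
move=> l0; apply: line_closed_irreducible.
  by eexists; apply: graph_base.
move=> x y t gx gy a; rewrite ffunE (gx a) (gy a).
have -> : \sum_(i < n) c a i * [ffun i => x i + t * (y i - x i)] (h i) =
    \sum_(i < n) c a i * x (h i) + t * (\sum_(i < n) c a i * y (h i) -
      \sum_(i < n) c a i * x (h i)).
  rewrite -sumrB mulr_sumr -big_split; apply: eq_bigr => i _ /=.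
  by rewrite ffunE; ring.
by ring.
Qed.

Context (Adm : {ffun I -> int} -> Prop) (s : seq {ffun I -> int}).
Hypothesis Adm0 : forall lam, Adm lam -> forall i, lam (h i) = 0.
Hypothesis Adm_fin : forall lam, Adm lam -> lam \in s.

(** Finitely many irreducible closed sets, none contained in another, are the components of their
    union. *)
Lemma irreducible_componentE C :
  irreducible_component [set x | exists2 lam, Adm lam & graph lam x] C <->
  exists2 lam, Adm lam & C = graph lam.
Proof.
set X := [set x | _].
have sub D : zariski_irreducible D -> D `<=` X ->
    exists2 lam, Adm lam & D `<=` graph lam.
  move=> Di DX.
  (* [s] may contain vectors outside [Adm]; for these [Z] is empty. *)
  pose Z lam := [set x | Adm lam /\ graph lam x].
  have [|x /DX[lam Al gx]|lam ls Dl] := @irreducible_finite_cover _ s Z D _ Di.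
  - move=> lam; have [Al|nAl] := pselect (Adm lam).
      have [P PE] := graph_closed lam; exists P; rewrite -PE.
      by apply/seteqP; split=> x; [case|].
    exists [set 1]; apply/seteqP; split=> x /=; first by case.
    by move=> /(_ 1 erefl) /eqP; rewrite meval1 oner_eq0.
  - by exists lam => //; apply: Adm_fin.
  have [[x /Dl[Al _]] _] := Di.
  by exists lam => // y /Dl[].
have gX lam : Adm lam -> graph lam `<=` X by move=> Al x gx; exists lam.
split=> [[Ci CX Cmax]|[lam Al ->]].
  have [lam Al Cl] := sub _ Ci CX; exists lam => //; apply/esym/Cmax => //.
    exact/graph_irreducible/Adm0.
  exact: gX.
split=> [||D Di DX lD]; [exact/graph_irreducible/Adm0|exact: gX|].
have [mu Am Dm] := sub _ Di DX; apply/seteqP; split=> //.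
by rewrite (graph_sub_eq (Adm0 Al) (subset_trans lD Dm)).
Qed.

End ZariskiLines.

(** * From irreducible components to an interval of regions *)

Lemma interval_finite (I : finType) (b t : {ffun I -> int}) :
  exists s : seq {ffun I -> int}, forall k, vle b k -> vle k t -> k \in s.
Proof.
pose N := (\sum_i `|(t i - b i)%R|)%N.
pose F (m : {ffun I -> 'I_N.+1}) : {ffun I -> int} :=
  [ffun i => b i + (nat_of_ord (m i))%:Z].
exists (map F (enum {ffun I -> 'I_N.+1})).
move=> k bk kt; apply/mapP.
exists [ffun i => inord `|(k i - b i)%R|]; first by rewrite mem_enum.
apply/ffunP => i; rewrite !ffunE inordK.
  by rewrite gez0_abs ?subr_ge0 // addrC subrK.
rewrite ltnS /N (bigD1 i) //= (leq_trans _ (leq_addr _ _)) //.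
by have := bk i; have := kt i; lia.
Qed.

Theorem theorem1p5 (R : realType) (V : vectType R) (dot : {dot V for idfun})
    (Phi : {fset V}) (n : nat) (Delta : n.-tuple V) :
  root_system dot Phi ->
  irreducible_roots dot Phi ->
  simple_system Phi Delta ->
  semidistributive_lattice (@H0_le R V dot Phi n Delta).
Proof.
move=> rPhi _ sD.
have [top [Rtop top0 admE]] := admittedE rPhi sD.
pose b := alcove0 Phi Delta.
have Rb : Rg dot b := region_alcove0 rPhi sD.
pose h (i : 'I_n) := FSetSub (simple_posroot sD i).
pose c (a : posroots Phi Delta) i : R :=
  coord (simple_coroots dot Delta) i (coroot dot (val a)).
have compE lam : shi_component dot lam = graph c h lam.
  (* Simple roots are positive, so [coord_at] reads an actual coordinate of [x]. *)
  have xh x i : coord_at x (tnth Delta i) = x (h i).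
    by rewrite /coord_at (_ : tnth Delta i = val (h i)) ?valK // (tnth_nth 0).
  by apply/seteqP; split=> x /= hx a; rewrite hx; congr (_ + _);
    apply: eq_bigr => i _; rewrite xh.
have adm0 lam : admitted dot lam -> forall i, lam (h i) = 0.
  move=> /admE[_ l0 lt] i; have := lt (h i); rewrite top0 => h1.
  by have := l0 (h i); rewrite ffunE => h2; apply/le_anti; rewrite h1 h2.
have [s sP] := interval_finite b top.
have adms lam : admitted dot lam -> lam \in s.
  by move=> /admE[_ h1 h2]; apply: sP.
have varE : @shi_variety _ _ dot Phi n Delta =
    [set x | exists2 lam, admitted dot lam & graph c h lam x]%classic.
  by apply/seteqP; split=> x /= [lam Al]; exists lam; rewrite // ?compE // -compE.
have compP C := irreducible_componentE c adm0 adms C.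
rewrite -varE in compP.
have comp_inj (lam mu : {ffun posroots Phi Delta -> int}) : admitted dot lam ->
    shi_component dot lam = shi_component dot mu -> lam = mu.
  move=> Al e; have := @graph_sub_eq R _ n c h lam mu (adm0 _ Al).
  by rewrite -!compE e; apply.
have ex (C : H0 dot Phi Delta) :
    exists lam, admitted dot lam /\ sval C = shi_component dot lam.
  by have [lam Al Cl] := (compP _).1 (svalP C); exists lam; rewrite compE.
pose g C := projT1 (cid (ex C)).
have gP C : admitted dot (g C) /\ sval C = shi_component dot (g C).
  exact: (projT2 (cid (ex C))).
(* A component is the X[lam] of its vector, so [g] is injective; [admE] makes the interval its
   image, and [comp_inj] turns [H0_le] into the componentwise order. *)
apply: (regions_interval_lattice (Rg_coxeter rPhi sD) Rb Rtop (g := g)).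
- move=> C D gCD; have : sval C = sval D by rewrite (gP C).2 (gP D).2 gCD.
  case: C D {gCD} => C pC [D pD] /= E; rewrite -E in pD *.
  by congr exist; apply: Prop_irrelevance.
- move=> k; rewrite -admE; split=> [[C <-]|Ak]; first exact: (gP C).1.
  have irr : irreducible_component (@shi_variety _ _ dot Phi n Delta)
      (shi_component dot k).
    by apply/compP; exists k; rewrite ?compE.
  exists (exist _ _ irr); have [Ag /= e] := gP (exist _ _ irr).
  exact/esym/comp_inj.
- move=> C D; split=> [[lam [gam [Al Ag Cl Dg le]]]|le].
    have -> : g C = lam.
      by apply: comp_inj; [exact: (gP C).1|rewrite -(gP C).2 Cl].
    have -> // : g D = gam.
    by apply: comp_inj; [exact: (gP D).1|rewrite -(gP D).2 Dg].
  by exists (g C), (g D); split=> //; have [] := gP C; have [] := gP D.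
Qed.
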